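(* Let $d\ge1$ and let $k\in[1,d]$ be a real number. Then the ($(d-1)$-dimensional) volume of the boundary of $\rho_{d,k}^\star$ is $$2^d d\left[\sum_{i=0}^{\lfloor k\rfloor-1}\frac{(-1)^i(k-1-i)^{d-1}}{i!\,(d-i-1)!}+\sqrt{d}\sum_{i=0}^{\lfloor k\rfloor}\frac{(-1)^i(k-i)^{d-1}}{i!\,(d-i)!}\right].$$
   Context: $\gamma_d=[-1,1]^d\subset\mathbb{R}^d$ is the hypercube, and $\beta_d=\mathrm{conv}\{\pm e_1,\dots,\pm e_d\}$ is the cross-polytope (the unit ball of the $1$-norm). For $k\in[1,d]$, $\rho_{d,k}=\mathrm{conv}\left(\beta_d\cup\frac1k\gamma_d\right)$ and $\rho_{d,k}^\star$ is its polar, that is, $\rho_{d,k}^\star=(k\beta_d)\cap\gamma_d$. The volume of the boundary is the sum of the $(d-1)$-dimensional volumes of the facets (counting measure when $d=1$, with $0^0=1$). *)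

(* Defs.v *)
From HB Require Import structures.
From mathcomp Require Import all_boot all_order all_algebra.
From mathcomp Require Import all_classical all_reals all_analysis.

Set Implicit Arguments.
Unset Strict Implicit.
Unset Printing Implicit Defensive.

Import Order.TTheory GRing.Theory Num.Theory.
Import numFieldNormedType.Exports.

Local Open Scope classical_set_scope.
Local Open Scope ring_scope.

(** n-dimensional Lebesgue measure, as an iterated product measure carried from
    R * R^n to R^(n+1).  On R^0, a single point, it is the Dirac (equivalently,
    counting) measure. *)

Section LebesgueStep.
Context {R : realType}.
Local Notation Rm := (measurableTypeR R).

Definition cons_pair n (xt : Rm * n.-tuple Rm) : n.+1.-tuple Rm :=
  [tuple of xt.1 :: xt.2].

Lemma measurable_cons_pair n :
  measurable_fun [set: Rm * n.-tuple Rm] (@cons_pair n).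
Proof. exact: measurable_cons. Qed.

Definition uncons_pair n (t : n.+1.-tuple Rm) : Rm * n.-tuple Rm :=
  (tnth t ord0, [tuple of behead t]).

Lemma measurable_uncons_pair n :
  measurable_fun [set: n.+1.-tuple Rm] (@uncons_pair n).
Proof.
by apply: measurable_fun_pair; [exact: measurable_tnth|exact: measurable_behead].
Qed.

Lemma cons_pairK n : cancel (@cons_pair n) (@uncons_pair n).
Proof. by move=> [x t]; congr pair; apply: val_inj. Qed.

Section Step.
Variables (n : nat) (mu : {sigma_finite_measure set (n.-tuple Rm) -> \bar R}).

Definition lebesgue_step : set (n.+1.-tuple Rm) -> \bar R :=
  pushforward (@lebesgue_measure R \x mu)%E (@cons_pair n).

Let mcons (A : set (n.+1.-tuple Rm)) :
  measurable A -> measurable (@cons_pair n @^-1` A).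
Proof.
by move=> mA; rewrite -[X in measurable X]setTI; exact: measurable_cons_pair.
Qed.

Let step0 : lebesgue_step set0 = 0%E.
Proof. by rewrite /lebesgue_step /pushforward preimage_set0 measure0. Qed.

Let step_ge0 A : (0 <= lebesgue_step A)%E.
Proof. by rewrite /lebesgue_step /pushforward; exact: measure_ge0. Qed.

Let step_sigma_additive : semi_sigma_additive lebesgue_step.
Proof.
move=> F mF tF mUF; rewrite /lebesgue_step /pushforward preimage_bigcup.
apply: measure_semi_sigma_additive.
- by move=> i; exact: mcons.
- apply/trivIsetP => /= i j _ _ ij; rewrite -preimage_setI.
  by move/trivIsetP : tF => /(_ _ _ _ _ ij) ->//; rewrite preimage_set0.
- by rewrite -preimage_bigcup; exact: mcons.
Qed.

HB.instance Definition _ := isMeasure.Build _ _ _ lebesgue_step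
  step0 step_ge0 step_sigma_additive.

Let step_sigma_finite : sigma_finite setT lebesgue_step.
Proof.
have /sigma_finiteP[F [TF ndF Foo]] := sigma_finiteT (@lebesgue_measure R).
have /sigma_finiteP[G [TG ndG Goo]] := sigma_finiteT mu.
exists (fun i => @uncons_pair n @^-1` (F i `*` G i)).
  apply/esym; rewrite -subTset => t _.
  have [i _ Fi] : (\bigcup_i F i) (tnth t ord0) by rewrite -TF.
  have [j _ Gj] : (\bigcup_j G j) [tuple of behead t] by rewrite -TG.
  exists (maxn i j) => //; split => /=.
    by move: Fi; exact/subsetPset/ndF/leq_maxl.
  by move: Gj; exact/subsetPset/ndG/leq_maxr.
move=> i; have [mF Fi] := Foo i; have [mG Gi] := Goo i; split.
  rewrite -[X in measurable X]setTI.
  by apply: measurable_uncons_pair => //; exact: measurableX.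
rewrite /lebesgue_step /pushforward -comp_preimage.
rewrite (_ : _ \o _ = id) ?preimage_id; last first.
  by apply/funext => t /=; rewrite cons_pairK.
by rewrite product_measure1E// lte_mul_pinfty// ge0_fin_numE.
Qed.

HB.instance Definition _ := Measure_isSigmaFinite.Build _ _ _ lebesgue_step
  step_sigma_finite.

End Step.
End LebesgueStep.

Fixpoint lebesgue_tuple (R : realType) (n : nat) :
    {sigma_finite_measure set (n.-tuple (measurableTypeR R)) -> \bar R} :=
  match n with
  | 0 => \d_[tuple]
  | m.+1 => lebesgue_step (lebesgue_tuple R m)
  end.

Section Geometry.
Context {R : realType}.
Implicit Types (d m : nat).

Definition dotp d (x y : 'rV[R]_d) : R := \sum_(i < d) x 0 i * y 0 i.

Definition conv_hull d (A : set 'rV[R]_d) : set 'rV[R]_d :=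
  smallest (@convex_set R 'rV[R]_d) A.

Definition polar d (A : set 'rV[R]_d) : set 'rV[R]_d :=
  [set y | forall x, A x -> dotp x y <= 1].

Definition supporting_halfspace d (P : set 'rV[R]_d) (a : 'rV[R]_d) (b : R) :=
  forall x, P x -> dotp a x <= b.

Definition is_face d (P F : set 'rV[R]_d) :=
  exists a b, supporting_halfspace P a b /\ F = P `&` [set x | dotp a x = b].

(** [affine_dim A m]: the affine hull of [A] has dimension [m].  The points [p]
    and [p + row i U] are an affine basis of that hull, picked inside [A]. *)
Definition affine_dim d (A : set 'rV[R]_d) m :=
  exists (p : 'rV[R]_d) (U : 'M[R]_(m, d)),
    [/\ A p, row_free U, forall i, A (p + row i U)
      & forall x, A x -> (x - p <= U)%MS].

(** Facets of a full-dimensional polytope [P] of R^d, [d >= 1]: requiring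
    dimension [d.-1] discards the improper faces [P] and [set0]. *)
Definition facets d (P : set 'rV[R]_d) : set (set 'rV[R]_d) :=
  [set F | is_face P F /\ affine_dim F d.-1].

(** The rows of [U] being orthonormal, [chart p U] is an isometry from R^m onto
    the m-flat through [p] directed by the row space of [U]. *)
Definition chart d m (p : 'rV[R]_d) (U : 'M[R]_(m, d))
    (t : m.-tuple (measurableTypeR R)) : 'rV[R]_d :=
  p + (\row_(i < m) tnth t i) *m U.

(** m-dimensional volume of a subset of an m-flat: Lebesgue measure read through
    an isometric chart of the flat.  [xget] picks the value given by some chart;
    for Borel [A] all charts give the same value, since Lebesgue measure is invariant under
    isometries. *)
Definition flat_volume d m (A : set 'rV[R]_d) : \bar R :=
  xget 0%E [set v | exists (p : 'rV[R]_d) (U : 'M[R]_(m, d)),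
    [/\ U *m U^T = 1%:M, A `<=` range (chart p U)
      & v = lebesgue_tuple R m (chart p U @^-1` A)]].

Definition boundary_volume d (P : set 'rV[R]_d) : \bar R :=
  \esum_(F in facets P) flat_volume d.-1 F.

Definition cube d : set 'rV[R]_d := [set x | forall i, `|x 0 i| <= 1].
Arguments cube d : clear implicits.

Definition cross_polytope d : set 'rV[R]_d :=
  conv_hull [set x | exists i : 'I_d, x = delta_mx 0 i \/ x = - delta_mx 0 i].
Arguments cross_polytope d : clear implicits.

Definition rho d (k : R) : set 'rV[R]_d :=
  conv_hull (cross_polytope d `|` [set k^-1 *: x | x in cube d]).

End Geometry.
Arguments cube {R} d.
Arguments cross_polytope {R} d.
Arguments rho {R} d k.

(* Main.v *)
(* A facet of the polar spans one of the hyperplanes x_i = +-1 or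
   sum_i e_i x_i = k with signs e_i: the barycenter of an affine basis of the
   facet must lie on one of these, and then so does the whole facet.  Forgetting
   one coordinate turns any isometric chart of a hyperplane with normal n into an
   affine bijection of R^(d-1) with determinant |n_i| / ||n||, so the volume of a
   facet is that of its coordinate projection times ||n|| / |n_i|.  Up to signs,
   the projections are 2^(d-1) copies of the part of the unit cube below the
   hyperplane sum = k - 1, and the slab k - 1 <= sum <= k of the unit cube.
   Integrating one coordinate at a time, the part of the cube [0,1]^n where
   sum <= s has as volume the n-th backward difference of max(s,0)^n / n!. *)
Require Import Defs.
From HB Require Import structures.
From mathcomp Require Import all_boot all_order all_algebra.
From mathcomp Require Import all_classical all_reals all_analysis.
From mathcomp Require Import measurable_realfun ring lra.
Import Order.TTheory GRing.Theory Num.Theory.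
Import numFieldNormedType.Exports.
Local Open Scope classical_set_scope.
Local Open Scope ring_scope.

Set Implicit Arguments.
Unset Strict Implicit.
Unset Printing Implicit Defensive.

(** * Change of variables for Lebesgue measure *)

Section LebesgueTuple.
Context {R : realType}.
Local Notation Rm := (measurableTypeR R).
Local Notation leb := (@lebesgue_measure R).
Local Notation consT x t := (cons_pair (x, t)).

(** The two families of hyperplanes do not always carry facets: for [k = d > 1] the sign hyperplanes
    touch the polar only at vertices, and for [k = 1 < d] the coordinate ones do. Only irredundant
    constraints are therefore indexed, each certified by a point that is tight for it and strict for
    all the others. The certificate shows both that the constraint cuts out a facet and that
    distinct constraints cut out distinct facets. The formula stays uniform because the term of a
    missing family evaluates to zero. When [d = 1], so that [k = 1] and the families coincide, the
    coordinate one is kept and its term rests on [0 ^+ 0 = 1]. As volume in a flat is read through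
    an unspecified isometric chart, the determinant of the projected chart serves twice: it yields
    the value, and it shows that the value is the same for all charts. *)

Let affR (a c : R) : Rm -> Rm := fun x => a * x + c.

Lemma measurable_affR (a c : R) : measurable_fun setT (affR a c).
Proof.
apply: (@measurable_funD _ _ R setT ( *%R a) (cst c)) => //.
Qed.

(** Both sides are measures in [A], so uniqueness of Lebesgue measure leaves only half-open
    intervals; a negative [a] exchanges their open and closed ends. *)
Lemma lebesgue_affine_preimage (a c : R) (A : set Rm) : a != 0 -> measurable A ->
  leb A = (`|a|%:E * leb [set x | A (a * x + c)%R])%E.
Proof.
move=> a0 mA.
pose r : {nonneg R} := NngNum (normr_ge0 a).
apply: (etrans (@lebesgue_measure_unique R
  (mscale r (pushforward leb (affR a c))) _ A mA)) => //.
  exact: measurable_affR.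
move=> maf _ [[u v] _ <-].
set B := affR a c @^-1` `]u, v]%classic.
suff : leb `]u, v]%classic = (`|a|%:E * leb B)%E by [].
have [lt0a|gt0a] : a < 0 \/ 0 < a by apply/orP; rewrite -neq_lt.
- have -> : B = `[(v - c) / a, (u - c) / a[%classic.
    apply/seteqP; split => x; rewrite /B/= /affR !in_itv/=;
      rewrite ler_ndivrMr// ltr_ndivlMr// => /andP[? ?]; apply/andP; split; nra.
  rewrite !lebesgue_measure_itv/= !lte_fin ltr_nM2r ?invr_lt0// ltrD2r.
  case: ifP => uv; rewrite ?mule0// -!EFinD -EFinM ltr0_norm//; congr EFin.
  by field.
- have -> : B = `](u - c) / a, (v - c) / a]%classic.
    apply/seteqP; split => x; rewrite /B/= /affR !in_itv/=;
      rewrite ler_pdivlMr// ltr_pdivrMr// => /andP[? ?]; apply/andP; split; nra.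
  rewrite !lebesgue_measure_itv/= !lte_fin ltr_pM2r ?invr_gt0// ltrD2r.
  case: ifP => uv; rewrite ?mule0// -!EFinD -EFinM gtr0_norm//; congr EFin.
  by field.
Qed.

Lemma lebesgue_tuple_xsection n (A : set (n.+1.-tuple Rm)) : measurable A ->
  lebesgue_tuple R n.+1 A =
  (\int[leb]_x lebesgue_tuple R n [set t | A (consT x t)])%E.
Proof.
move=> mA; rewrite /= /lebesgue_step /pushforward /product_measure1.
apply: eq_integral => x _ /=; congr (lebesgue_tuple R n _).
by apply/seteqP; split => t; rewrite /xsection/= inE.
Qed.

Lemma lebesgue_tuple_ysection n (A : set (n.+1.-tuple Rm)) : measurable A ->
  lebesgue_tuple R n.+1 A =
  (\int[lebesgue_tuple R n]_t leb [set x : Rm | A (consT x t)])%E.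
Proof.
move=> mA; rewrite /= /lebesgue_step /pushforward.
rewrite (product_measure_unique (m1 := leb) (m2 := lebesgue_tuple R n)
  (m' := (leb \x^ lebesgue_tuple R n)%E))//=.
- rewrite /product_measure2; apply: eq_integral => t _ /=; congr (leb _).
  by apply/seteqP; split => x; rewrite /ysection/= inE.
- by move=> B C mB mC; rewrite product_measure2E.
- by rewrite -[X in measurable X]setTI; exact: measurable_cons_pair.
Qed.

(** Measurability lives on tuples and linear algebra on row vectors. [rowt] passes from the former
    to the latter, while [affmap] keeps affine maps on the tuple side. *)
Definition rowt n (t : n.-tuple Rm) : 'rV[R]_n := \row_(i < n) tnth t i.

Definition affmap m n (q : 'rV[R]_n) (V : 'M[R]_(m, n)) (t : m.-tuple Rm) :
    n.-tuple Rm :=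
  [tuple (q + rowt t *m V) 0 j | j < n].

Lemma rowt_affmap m n (q : 'rV[R]_n) (V : 'M[R]_(m, n)) t :
  rowt (affmap q V t) = q + rowt t *m V.
Proof. by apply/rowP => j; rewrite mxE tnth_mktuple. Qed.

Lemma rowt_inj n : injective (@rowt n).
Proof.
by move=> s t /rowP st; apply: eq_from_tnth => i; have := st i; rewrite !mxE.
Qed.

Lemma affmap_comp m n p (q : 'rV[R]_n) (V : 'M[R]_(m, n)) (r : 'rV[R]_p)
    (W : 'M[R]_(n, p)) t :
  affmap r W (affmap q V t) = affmap (r + q *m W) (V *m W) t.
Proof.
by apply: rowt_inj; rewrite !rowt_affmap mulmxDl mulmxA addrA.
Qed.

Lemma measurable_affmap m n (q : 'rV[R]_n) (V : 'M[R]_(m, n)) :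
  measurable_fun setT (affmap q V).
Proof.
apply/measurable_fun_tnthP => j.
rewrite (_ : _ \o _ = fun t => q 0 j + \sum_(i < m) tnth t i * V i j); last first.
  apply/funext => t /=; rewrite tnth_mktuple !mxE; congr +%R.
  by apply: eq_bigr => i _; rewrite mxE.
apply: measurable_funD => //; apply: measurable_sum => i.
by apply: measurable_funM => //; exact: measurable_tnth.
Qed.

Lemma measurable_preimage_affmap m n (q : 'rV[R]_n) (V : 'M[R]_(m, n)) A :
  measurable A -> measurable (affmap q V @^-1` A).
Proof.
by move=> mA; rewrite -[X in measurable X]setTI; exact: measurable_affmap.
Qed.

Lemma measurable_cons_section n (A : set (n.+1.-tuple Rm)) x : measurable A ->
  measurable [set t | A (consT x t)].
Proof.
move=> mA; rewrite -[X in measurable X]setTI.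
by apply: (measurable_cons (f := cst x) (g := id)).
Qed.

Lemma measurable_head_section n (A : set (n.+1.-tuple Rm)) t : measurable A ->
  measurable [set x | A (consT x t)].
Proof.
move=> mA; rewrite -[X in measurable X]setTI.
by apply: (measurable_cons (f := id) (g := cst t)).
Qed.

Lemma rowt_cons n x (t : n.-tuple Rm) :
  rowt (consT x t) = row_mx x%:M (rowt t) :> 'rV_(1 + n).
Proof.
apply/rowP => i; rewrite mxE; case: (@split_ordP 1 n i) => j ->.
  by rewrite row_mxEl ord1 !mxE eqxx mulr1n.
rewrite row_mxEr mxE (_ : rshift 1 j = lift ord0 j); last exact: val_inj.
by rewrite tnthS.
Qed.

Lemma affmap_cons n (q0 : R) (q : 'rV[R]_n) (a : R) (b : 'rV[R]_n)
    (c : 'cV[R]_n) (D : 'M[R]_n) x t :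
  affmap (row_mx q0%:M q : 'rV_(1 + n)) (block_mx a%:M b c D : 'M[R]_(1 + n))
    (consT x t) =
  consT (a * x + (q0 + (rowt t *m c) 0 0)) (affmap (q + x *: b) D t).
Proof.
apply: rowt_inj; rewrite rowt_affmap !rowt_cons rowt_affmap.
rewrite mul_row_block add_row_mx; congr row_mx.
  apply/rowP => j; rewrite ord1 !mxE eqxx !mulr1n big_ord1 !mxE eqxx !mulr1n.
  by rewrite mulrC addrCA.
by rewrite -scalar_mxC mul_mx_scalar addrA.
Qed.

(** All translations [q] are included because, in the induction, the tail is translated by an amount
    that depends on the head coordinate. *)
Definition scales_volume n (V : 'M[R]_n) := forall q (A : set (n.-tuple Rm)),
  measurable A ->
  lebesgue_tuple R n A =
  (`|\det V|%R%:E * lebesgue_tuple R n [set t | A (affmap q V t)])%E.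

Lemma measurable_fun_head_section n (A : set (n.+1.-tuple Rm)) : measurable A ->
  measurable_fun setT (fun t => leb [set x | A (consT x t)]).
Proof.
move=> mA.
have mcA : measurable (@cons_pair R n @^-1` A).
  by rewrite -[X in measurable X]setTI; exact: measurable_cons_pair.
have := measurable_fun_ysection leb mcA; congr measurable_fun.
apply/funext => t /=; congr (leb _).
by apply/seteqP; split => x; rewrite /ysection/= inE.
Qed.

Lemma measurable_fun_cons_section n (A : set (n.+1.-tuple Rm)) : measurable A ->
  measurable_fun setT (fun x => lebesgue_tuple R n [set t | A (consT x t)]).
Proof.
move=> mA.
have mcA : measurable (@cons_pair R n @^-1` A).
  by rewrite -[X in measurable X]setTI; exact: measurable_cons_pair.
have := measurable_fun_xsection (lebesgue_tuple R n) mcA; congr measurable_fun.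
apply/funext => t /=; congr (lebesgue_tuple R n _).
by apply/seteqP; split => x; rewrite /xsection/= inE.
Qed.

(** With the tail [t] frozen, the map is affine on the line, with slope [a] and an intercept
    depending on [t]; hence the slicing by tails. *)
Lemma lebesgue_tuple_head n (a q0 : R) (c : 'cV[R]_n) (A : set (n.+1.-tuple Rm)) :
  a != 0 -> measurable A ->
  lebesgue_tuple R n.+1 A = (`|a|%R%:E * lebesgue_tuple R n.+1
    [set s | A (affmap (row_mx q0%:M 0%R : 'rV[R]_(1 + n))
                 (block_mx a%:M 0%R c 1%:M : 'M[R]_(1 + n)) s)])%E.
Proof.
move=> a0 mA.
have mB := measurable_preimage_affmap
  (row_mx q0%:M 0%R : 'rV[R]_(1 + n)) (block_mx a%:M 0%R c 1%:M : 'M[R]_(1 + n)) mA.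
rewrite !lebesgue_tuple_ysection//.
rewrite -ge0_integralZl//; last exact: measurable_fun_head_section.
apply: eq_integral => t _.
rewrite (@lebesgue_affine_preimage a (q0 + (rowt t *m c) 0 0))//; last first.
  exact: measurable_head_section.
congr (_ * leb _)%E; apply/seteqP; split => x /=; rewrite affmap_cons;
  by rewrite scaler0 add0r (_ : affmap 0 1%:M t = t)//;
     apply: rowt_inj; rewrite rowt_affmap mulmx1 add0r.
Qed.

Lemma lebesgue_tuple_tail n (q b : 'rV[R]_n) (D : 'M[R]_n)
    (A : set (n.+1.-tuple Rm)) : scales_volume D -> measurable A ->
  lebesgue_tuple R n.+1 A = (`|\det D|%R%:E * lebesgue_tuple R n.+1
    [set s | A (affmap (row_mx 0%:M q : 'rV[R]_(1 + n))
                 (block_mx 1%:M b 0%R D : 'M[R]_(1 + n)) s)])%E.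
Proof.
move=> dD mA.
have mB := measurable_preimage_affmap
  (row_mx 0%:M q : 'rV[R]_(1 + n)) (block_mx 1%:M b 0%R D : 'M[R]_(1 + n)) mA.
rewrite !lebesgue_tuple_xsection//.
rewrite -ge0_integralZl//; last exact: measurable_fun_cons_section.
apply: eq_integral => x _.
rewrite (dD (q + x *: b)); last exact: measurable_cons_section.
congr (_ * lebesgue_tuple R n _)%E; apply/seteqP; split => t /=;
  by rewrite affmap_cons mulmx0 mxE mul1r !addr0.
Qed.

Lemma scales_volume_block n (a : R) (b : 'rV[R]_n) (c : 'cV[R]_n) (D : 'M[R]_n) :
  (forall V : 'M[R]_n, V \in unitmx -> scales_volume V) ->
  a != 0 -> (block_mx a%:M b c D : 'M[R]_(1 + n)) \in unitmx ->
  scales_volume (block_mx a%:M b c D : 'M[R]_(1 + n)).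
Proof.
move=> IH a0 uW q A mA.
(* [S] is the Schur complement of the pivot [a]. *)
pose b' := a^-1 *: b; pose S := D - c *m b'.
pose W1 := block_mx a%:M 0 c 1%:M : 'M[R]_(1 + n).
pose W2 := block_mx 1%:M b' 0 S : 'M[R]_(1 + n).
have eW : W1 *m W2 = block_mx a%:M b c D.
  rewrite mulmx_block !mulmx1 !mulmx0 !mul0mx !addr0 !mul1mx mul_scalar_mx.
  by rewrite scalerA divff// scale1r /S addrC subrK.
have detW : \det W1 = a.
  by rewrite det_lblock det1 mulr1 det_scalar expr1.
have uS : S \in unitmx.
  move: uW; rewrite -eW unitmx_mul => /andP[_].
  by rewrite /W2 !unitmxE det_ublock det1 mul1r.
have detW2 : \det W2 = \det S by rewrite det_ublock det1 mul1r.
pose q0 := (lsubmx (q : 'rV[R]_(1 + n))) 0 0.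
pose q' := rsubmx (q : 'rV[R]_(1 + n)).
have eq : q = row_mx q0%:M q' :> 'rV[R]_(1 + n).
  by rewrite -[LHS]hsubmxK /q0 -mx11_scalar.
(* [W2] turns the head translation [q0] into an extra tail translation [q0 *: b'], which is
   subtracted here in advance. *)
rewrite (lebesgue_tuple_tail (q' - q0 *: b') b' (IH _ uS) mA).
rewrite (lebesgue_tuple_head q0 c a0); last exact: measurable_preimage_affmap.
rewrite muleA -EFinM -normrM -eW det_mulmx detW detW2 mulrC.
congr (_ * lebesgue_tuple R _ _)%E; apply/seteqP; split => t /=;
  by rewrite affmap_comp mul_row_block mulmx1 mulmx0 addr0 mul0mx addr0
      add_row_mx raddf0 add0r mul_scalar_mx subrK eq.
Qed.

(* Block elimination with the top left entry as pivot factors [V] through a map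
   acting on the head coordinate only and one acting on the tail only; a shear
   provides a nonzero pivot. *)
Lemma scales_volume_unitmx n (V : 'M[R]_n) : V \in unitmx -> scales_volume V.
Proof.
elim: n V => [|n IH] V.
  move=> _ q A mA; rewrite det_mx00 normr1 mul1e; congr (lebesgue_tuple R 0 _).
  by apply/seteqP; split => t /=; rewrite !(tuple0 (affmap _ _ _)) (tuple0 t).
have [W eV] : exists W : 'M[R]_(1 + n), V = W by exists V.
rewrite {}eV; clear V => uW.
have pivot (V : 'M[R]_(1 + n)) : V \in unitmx -> V 0 0 != 0 -> scales_volume V.
  move=> uV V00; rewrite -[V]submxK (mx11_scalar (ulsubmx V)).
  apply: scales_volume_block => //.
    by rewrite !mxE (_ : lshift n 0 = 0)//; exact: val_inj.
  by rewrite -mx11_scalar submxK.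
have [W00|] := eqVneq (W 0 0) 0; last exact: pivot.
have [j Wj] : exists j : 'I_n, W 0 (lift ord0 j) != 0.
  apply/existsP; rewrite -[X in is_true X]negbK negb_exists.
  apply/negP => /forallP W0; move: uW.
  rewrite unitmxE (expand_det_row _ ord0) big1 ?unitr0// => i _.
  have [k ->|->] := unliftP ord0 i; last by rewrite W00 mul0r.
  by have := W0 k; rewrite negbK => /eqP ->; rewrite mul0r.
(* Multiplying a row vector by [E e] adds [e] times its tail entry [j] to its head. Hence [W *m E 1]
   has pivot [W 0 (lift ord0 j)], and [E (-1)] undoes the shear. *)
pose E (e : R) := block_mx 1%:M 0 (e *: delta_mx j 0) 1%:M : 'M[R]_(1 + n).
have detE e : \det (E e) = 1 by rewrite det_lblock !det1 mulr1.
have E0 (k : 'I_n) : E 1 (lift ord0 k) 0 = (k == j)%:R.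
  rewrite !mxE; case: splitP => [l /= kl|l /= [kl]].
    by have := ltn_ord l; rewrite -kl.
  rewrite mxE; case: splitP => [i _|//].
  by rewrite !mxE ord1 eqxx andbT mul1r -(val_inj kl : k = l).
have EK : E 1 *m E (-1) = 1%:M.
  rewrite mulmx_block !mulmx1 !mul1mx !mulmx0 !mul0mx !addr0 add0r.
  by rewrite -scalerDl subrr scale0r -scalar_mx_block.
move=> q A mA.
rewrite (lebesgue_tuple_head 0 (-1 *: delta_mx j 0) (oner_neq0 R) mA).
rewrite -/(E (-1)) normr1 mul1e.
rewrite (pivot (W *m E 1) _ _ (q *m E 1)); last 3 first.
- by rewrite unitmx_mul uW unitmxE detE unitr1.
- by rewrite mxE (@big_ord_recl _ _ _ n) W00 mul0r add0r (bigD1 j)//= big1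
    ?addr0 ?E0 ?eqxx ?mulr1// => k kj; rewrite E0 (negbTE kj) mulr0.
- exact: measurable_preimage_affmap.
rewrite det_mulmx detE mulr1; congr (_ * lebesgue_tuple R _ _)%E.
by apply/seteqP; split => t /=;
  rewrite affmap_comp -!mulmxA EK !mulmx1 raddf0 row_mx0 add0r.
Qed.

End LebesgueTuple.

(** * Volumes of truncated cubes *)

Section BoxVolume.
Context {R : realType}.
Local Notation Rm := (measurableTypeR R).
Local Notation leb := (@lebesgue_measure R).
Local Notation consT x t := (cons_pair (x, t)).

Lemma integral_deriv_poly (p : {poly R}) (a b : R) : a <= b ->
  (\int[leb]_(x in `[a, b]) (p^`().[x])%:E = (p.[b] - p.[a])%:E)%E.
Proof.
rewrite le_eqVlt => /predU1P[->|ab]; first by rewrite set_itv1 integral_set1 subrr.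
rewrite EFinB; apply: continuous_FTC2 => //.
- by apply: continuous_subspaceT => x; exact: continuous_horner.
- split => [x _||].
  + exact: derivable_horner.
  + by apply: cvg_at_right_filter; exact: continuous_horner.
  + by apply: cvg_at_left_filter; exact: continuous_horner.
- by move=> x _; rewrite derivE.
Qed.

(* The positive part of [y ^+ n / n!], with [0 ^+ 0 = 1] at [y = 0]. *)
Definition tpow (n : nat) (y : R) : R := if 0 <= y then y ^+ n / n`!%:R else 0.

Lemma tpow_ge0 n y : 0 <= tpow n y.
Proof.
by rewrite /tpow; case: ifP => // y0; rewrite divr_ge0// exprn_ge0.
Qed.

Lemma measurable_tpow n (s : R) : measurable_fun setT (fun x : R => tpow n (s - x)).
Proof.
rewrite /tpow; apply: measurable_fun_ifT => //=.
  by apply: measurable_fun_ler => //; exact: measurable_funB.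
apply: measurable_funM => //; apply: measurable_funX; exact: measurable_funB.
Qed.

Lemma integral_tpow n (s : R) :
  (\int[leb]_(x in `[0%R, 1%R]) (tpow n (s - x))%:E =
    (tpow n.+1 s - tpow n.+1 (s - 1))%:E)%E.
Proof.
have [s0|s0] := leP 0 s; last first.
  rewrite /tpow [0 <= s]leNgt s0/= leNgt ifN; last by rewrite negbK; lra.
  rewrite subrr integral0_eq// => x /=; rewrite in_itv/= => /andP[x0 _].
  by rewrite ifF//; apply/negbTE; rewrite -ltNge; lra.
(* The integrand vanishes beyond [s]; up to [m] it is a polynomial, with primitive [p] below. *)
pose m := Num.min s 1.
have m0 : 0 <= m by rewrite le_min s0 ler01.
have -> : (\int[leb]_(x in `[0%R, 1%R]) (tpow n (s - x))%:E =
    \int[leb]_(x in `[0%R, m]) ((s - x) ^+ n / n`!%:R)%:E)%E.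
  rewrite -[in RHS](setIidr (_ : `[0%R, m] `<=` `[0%R, 1%R])); last first.
    by move=> x/=; rewrite !in_itv/= le_min => /and3P[-> _ ->].
  rewrite integral_mkcondr; apply: eq_integral => x.
  rewrite inE/= in_itv/= => /andP[x0 x1].
  rewrite patchE /tpow mem_setE in_itv/= x0 le_min x1 andbT/= subr_ge0.
  by case: ifP.
pose p : {poly R} := - (n.+1`!%:R^-1) *: (s%:P - 'X) ^+ n.+1.
have -> : (\int[leb]_(x in `[0%R, m]) ((s - x) ^+ n / n`!%:R)%:E =
    \int[leb]_(x in `[0%R, m]) (p^`().[x])%:E)%E.
  apply: eq_integral => x _; congr EFin.
  rewrite /p derivZ deriv_exp derivB derivC derivX !(hornerE, hornerMn)/= factS natrM.
  have n0 : n.+1%:R != 0 :> R by rewrite pnatr_eq0.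
  have f0 : n`!%:R != 0 :> R by rewrite pnatr_eq0 -lt0n fact_gt0.
  by rewrite -mulr_natr; field; rewrite f0 nat1r n0.
rewrite integral_deriv_poly//; congr EFin.
rewrite /p !hornerE /tpow s0 subr_ge0 /m subr0; move: (_%:R^-1) => c.
case: (ltgtP s 1) => [s1|s1|->]; rewrite ?subrr ?expr0n/=; ring.
Qed.

Lemma integrable_tpow n (s : R) :
  leb.-integrable `[0%R, 1%R] (fun x => (tpow n (s - x))%:E).
Proof.
apply/integrableP; split.
  by apply/measurable_EFinP; apply: measurable_funTS; exact: measurable_tpow.
under eq_integral do rewrite gee0_abs ?lee_fin ?tpow_ge0//.
by rewrite integral_tpow ltry.
Qed.

Definition bdiff (f : R -> R) (s : R) : R := f s - f (s - 1).

Lemma iter_bdiff n (f : R -> R) s :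
  iter n bdiff f s = \sum_(0 <= i < n.+1) (-1) ^+ i * 'C(n, i)%:R * f (s - i%:R).
Proof.
elim: n s => [|n IH] s; first by rewrite big_nat1 subr0 expr0 bin0 !mul1r.
rewrite iterS /bdiff !IH.
have -> : \sum_(0 <= i < n.+1) (-1) ^+ i * 'C(n, i)%:R * f (s - i%:R) =
    \sum_(0 <= i < n.+2) (-1) ^+ i * 'C(n, i)%:R * f (s - i%:R).
  by rewrite [RHS]big_nat_recr//= bin_small// mulr0 mul0r addr0.
rewrite [RHS]big_nat_recl// [X in X - _]big_nat_recl// !bin0 -addrA.
congr +%R; rewrite -sumrB; apply: eq_bigr => i _.
rewrite binS natrD exprS.
have -> : s - 1 - i%:R = s - i.+1%:R by rewrite mulrSr; ring.
by ring.
Qed.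

(** Integration over the unit interval raises the power and takes one backward difference, and it
    commutes with the differences already present. These make the integrand a signed combination, so
    integrability is carried through the induction to allow linearity. *)
Lemma integral_iter_bdiff_tpow m n (s : R) :
  leb.-integrable `[0%R, 1%R] (fun x => (iter m bdiff (tpow n) (s - x))%:E) /\
  (\int[leb]_(x in `[0%R, 1%R]) (iter m bdiff (tpow n) (s - x))%:E =
    (iter m.+1 bdiff (tpow n.+1) s)%:E)%E.
Proof.
elim: m s => [|m IH] s.
  by split; [exact: integrable_tpow|rewrite integral_tpow].
have [i1 e1] := IH s; have [i2 e2] := IH (s - 1).
have e x : iter m.+1 bdiff (tpow n) (s - x) =
    iter m bdiff (tpow n) (s - x) - iter m bdiff (tpow n) (s - 1 - x).
  by rewrite iterS /bdiff (_ : s - 1 - x = s - x - 1)//; ring.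
split.
  have -> : (fun x => (iter m.+1 bdiff (tpow n) (s - x))%:E) =
      ((fun x => (iter m bdiff (tpow n) (s - x))%:E) \-
       (fun x => (iter m bdiff (tpow n) (s - 1 - x))%:E))%E.
    by apply/funext => x; rewrite e EFinB.
  exact: integrableB.
under eq_integral do rewrite e.
by rewrite integralB_EFin// e1 e2 -EFinB.
Qed.

(** The condition on the sum is an arbitrary set [P], so that fixing one coordinate gives a set of
    the same kind with [P] translated. *)
Definition boxset (n : nat) (P : set R) : set (n.-tuple Rm) :=
  [set t | (forall i, 0 <= tnth t i <= 1) /\ P (\sum_(i < n) tnth t i)].

Definition symset (n : nat) (P : set R) : set (n.-tuple Rm) :=
  [set t | (forall i, `|tnth t i| <= 1) /\ P (\sum_(i < n) `|tnth t i|)].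

Arguments boxset : clear implicits.
Arguments symset : clear implicits.

Lemma sum_cons_pair n (f : R -> R) x (t : n.-tuple Rm) :
  \sum_(i < n.+1) f (tnth (consT x t) i) = f x + \sum_(i < n) f (tnth t i).
Proof.
rewrite big_ord_recl (tnth0 x t); congr +%R.
by apply: eq_bigr => i _; rewrite tnthS.
Qed.

Lemma measurable_tuple_sum n (f : R -> R) : measurable_fun setT f ->
  measurable_fun setT (fun t : n.-tuple Rm => \sum_(i < n) f (tnth t i)).
Proof.
move=> mf; apply: measurable_sum => i.
by apply: (measurableT_comp mf); exact: measurable_tnth.
Qed.

Lemma measurable_tuple_sum_preimage n (f : R -> R) (P : set R) :
  measurable_fun setT f -> measurable P ->
  measurable [set t : n.-tuple Rm | P (\sum_(i < n) f (tnth t i))].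
Proof.
move=> mf mP; rewrite -[X in measurable X]setTI.
by apply: (measurable_tuple_sum mf).
Qed.

Lemma measurable_tuple_forall n (P : set R) : measurable P ->
  measurable [set t : n.-tuple Rm | forall i, P (tnth t i)].
Proof.
move=> mP.
rewrite (_ : mkset _ = \bigcap_(i in [set: 'I_n]) (fun t => tnth t i) @^-1` P).
  apply: fin_bigcap_measurable => // i _.
  by rewrite -[X in measurable X]setTI; exact: measurable_tnth.
by apply/seteqP; split => t /= H i; [move=> _|]; exact: H.
Qed.

Lemma measurable_boxset n P : measurable P -> measurable (boxset n P).
Proof.
move=> mP; apply: measurableI.
  rewrite [X in measurable X](_ : _ =
      [set t : n.-tuple Rm | forall i, `[0, 1]%classic (tnth t i)]).
    by apply: measurable_tuple_forall; exact: measurable_itv.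
  by apply/seteqP; split => t /= H i; have := H i; rewrite in_itv.
  exact: (measurable_tuple_sum_preimage _ (f := id)).
Qed.

Lemma measurable_symset n P : measurable P -> measurable (symset n P).
Proof.
move=> mP; apply: measurableI.
  rewrite [X in measurable X](_ : _ =
      [set t : n.-tuple Rm | forall i, `[-1, 1]%classic (tnth t i)]).
    by apply: measurable_tuple_forall; exact: measurable_itv.
  by apply/seteqP; split => t /= H i; have := H i; rewrite in_itv/= ler_norml.
  exact: (measurable_tuple_sum_preimage _ (f := Num.norm)).
Qed.

Lemma lebesgue_boxset_recl n P : measurable P ->
  lebesgue_tuple R n.+1 (boxset n.+1 P) =
  (\int[leb]_(x in `[0%R, 1%R])
     lebesgue_tuple R n (boxset n [set y | P (x + y)%R]))%E.
Proof.
move=> mP; rewrite lebesgue_tuple_xsection; last exact: measurable_boxset.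
rewrite [RHS]integral_mkcond; apply: eq_integral => x _.
rewrite patchE; case: ifPn; rewrite ?inE ?notin_setE/= in_itv/= => x01.
  congr (lebesgue_tuple R n _); apply/seteqP; split => t [/= H].
    rewrite (sum_cons_pair id) => PS; split => // i.
    by have := H (lift ord0 i); rewrite tnthS.
  move=> PS; split => /=; last first.
    by rewrite (sum_cons_pair id).
  by move=> i; have [j ->|->] := unliftP ord0 i; rewrite ?tnthS// tnth0.
rewrite (_ : mkset _ = set0) ?measure0//; apply/seteqP; split => // t [/= H _].
by apply: x01; have := H ord0; rewrite tnth0.
Qed.

Lemma lebesgue_symset_recl n P : measurable P ->
  lebesgue_tuple R n.+1 (symset n.+1 P) =
  (\int[leb]_(x in `[(-1)%R, 1%R])
     lebesgue_tuple R n (symset n [set y | P (`|x| + y)%R]))%E.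
Proof.
move=> mP; rewrite lebesgue_tuple_xsection; last exact: measurable_symset.
rewrite [RHS]integral_mkcond; apply: eq_integral => x _.
rewrite patchE; case: ifPn; rewrite ?inE ?notin_setE/= in_itv/= -ler_norml => x01.
  congr (lebesgue_tuple R n _); apply/seteqP; split => t [/= H].
    rewrite (sum_cons_pair Num.norm) => PS; split => // i.
    by have := H (lift ord0 i); rewrite tnthS.
  move=> PS; split => /=; last first.
    by rewrite (sum_cons_pair Num.norm).
  by move=> i; have [j ->|->] := unliftP ord0 i; rewrite ?tnthS// tnth0.
rewrite (_ : mkset _ = set0) ?measure0//; apply/seteqP; split => // t [/= H _].
by apply: x01; have := H ord0; rewrite tnth0.
Qed.

Lemma measurable_le_set (s : R) : measurable [set y : Rm | y <= s].
Proof. by rewrite -set_itvNyc; exact: measurable_itv. Qed.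

Lemma lebesgue_boxset_le n (s : R) :
  lebesgue_tuple R n (boxset n [set y | y <= s]) = (iter n bdiff (tpow n) s)%:E.
Proof.
elim: n s => [|n IH] s.
  (* On R^0 the only sum is 0, so the Dirac measure returns 1 exactly when [0 <= s]; this is why
     [tpow] uses a weak inequality. *)
  rewrite /= diracE /tpow expr0 fact0 divr1; congr EFin.
  rewrite /boxset /mkset; case: ifPn => s0.
    by rewrite mem_set//=; split => [[]//|]; rewrite big_ord0.
  by rewrite memNset//= => -[_]; rewrite big_ord0; apply/negP.
rewrite lebesgue_boxset_recl; last exact: measurable_le_set.
rewrite -(proj2 (integral_iter_bdiff_tpow n n s)).
apply: eq_integral => x _; rewrite -IH; congr (lebesgue_tuple R n (boxset n _)).
by apply/seteqP; split => y /=; rewrite lerBrDl.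
Qed.

Lemma integral_even_itv (f : R -> \bar R) (a : R) : 0 <= a ->
  measurable_fun setT f -> (forall x, 0 <= f x)%E -> (forall x, f (- x)%R = f x) ->
  (\int[leb]_(x in `[(- a)%R, a]) f x = 2%:E * \int[leb]_(x in `[0%R, a]) f x)%E.
Proof.
move=> a0 mf f0 fN.
have -> : `[- a, a]%classic = `[- a, 0[%classic `|` `[0, a]%classic.
  by rewrite -itv_bndbnd_setU// bnd_simp// oppr_le0.
rewrite ge0_integral_setU//=; last 2 first.
- exact: measurable_funTS.
- rewrite disj_set2E; apply/eqP/seteqP; split => // x /=; rewrite !in_itv/=.
  by move=> [/andP[_ x0] /andP[]]; rewrite leNgt x0.
rewrite mule_natl mule2n; congr +%E.
rewrite -[RHS]integral_itv_obnd_cbnd; last exact: measurable_funTS.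
have -> : `[- a, 0[%classic = (-%R : R -> measurableTypeR R) @^-1` `]0, a].
  by rewrite opp_preimage_itvbndbnd/= oppr0.
transitivity
  (\int[pushforward leb (-%R : R -> measurableTypeR R)]_(x in `]0%R, a]) f x)%E.
  rewrite ge0_integral_pushforward//=; last exact: measurable_funTS.
  by apply: eq_integral => x _ /=; rewrite fN.
by apply: eq_measure_integral => //= A mA _; exact: lebesgue_measureN.
Qed.

Lemma measurable_fun_boxset_shift n P : measurable P ->
  measurable_fun setT
    (fun x : R => lebesgue_tuple R n (boxset n [set y | P (x + y)])).
Proof.
move=> mP.
(* [A] leaves the head coordinate free, so that its section at [x] is the translated box set. *)
pose A := [set s : n.+1.-tuple Rm |
  (forall i : 'I_n, `[0, 1]%classic (tnth s (lift ord0 i))) /\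
  P (\sum_(i < n.+1) tnth s i)].
have m01 : measurable (`[0, 1]%classic : set Rm) by exact: measurable_itv.
have mA : measurable A.
  apply: measurableI.
    rewrite [X in measurable X](_ : _ = \bigcap_(i in [set: 'I_n])
        (fun s : n.+1.-tuple Rm => tnth s (lift ord0 i)) @^-1` `[0, 1]%classic).
      apply: fin_bigcap_measurable => // i _.
      by rewrite -[X in measurable X]setTI; exact: measurable_tnth.
    by apply/seteqP; split => t /= H i; [move=> _|]; exact: H.
  exact: (measurable_tuple_sum_preimage _ (f := id)).
have := measurable_fun_cons_section mA; congr measurable_fun.
apply/funext => x; congr (lebesgue_tuple R n _).
apply/seteqP; split => t; rewrite /A/= (sum_cons_pair id);
  by move=> [H1 H2]; split => // i; have := H1 i; rewrite tnthS in_itv.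
Qed.

(** The slice volume is an even function of the head coordinate, so each coordinate contributes a
    factor 2. *)
Lemma lebesgue_symset_boxset n P : measurable P ->
  lebesgue_tuple R n (symset n P) = ((2 ^+ n)%:E * lebesgue_tuple R n (boxset n P))%E.
Proof.
elim: n P => [|n IH] P mP.
  rewrite expr0 mul1e; congr (lebesgue_tuple R 0 _).
  apply/seteqP; split => t [/= _]; rewrite !big_ord0 => P0;
    by split=> [[]//|]; rewrite /= big_ord0.
have mPx (x : R) : measurable [set y : Rm | P (x + y)].
  rewrite -[X in measurable X]setTI.
  by apply: (@measurable_funD _ _ R setT (cst x) id).
have mbox := measurable_fun_boxset_shift n mP.
rewrite lebesgue_symset_recl// lebesgue_boxset_recl//.
under eq_integral do rewrite (IH _ (mPx _)).
rewrite integral_even_itv//=.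
- rewrite exprS EFinM -muleA; congr (_ * _)%E.
  rewrite -ge0_integralZl//=.
    apply: eq_integral => x; rewrite inE/= in_itv/= => /andP[x0 _].
    by rewrite ger0_norm.
  exact: measurable_funTS.
- apply: measurable_funeM; apply: (measurableT_comp mbox); exact: normr_measurable.
- by move=> x; rewrite mule_ge0.
- by move=> x; rewrite normrN.
Qed.

Lemma lebesgue_hyperplane n (c : R) :
  lebesgue_tuple R n.+1 [set t | \sum_(i < n.+1) tnth t i = c] = 0%E.
Proof.
rewrite lebesgue_tuple_ysection; last first.
  exact: (measurable_tuple_sum_preimage _ (f := id) (P := [set c])).
rewrite integral0_eq// => t _.
rewrite (_ : mkset _ = [set c - \sum_(i < n) tnth t i]) ?lebesgue_measure_set1//.
apply/seteqP; split => x /=; rewrite (sum_cons_pair id).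
  by move=> <-; rewrite addrK.
by move=> ->; rewrite subrK.
Qed.

(** The slab and the part below it overlap only in a hyperplane, which is null; subtracting volumes
    supplies the last difference. The dimension is [n.+1] because on R^0 the overlap can be the
    whole space, of measure 1. *)
Lemma lebesgue_boxset_slab n (s : R) :
  lebesgue_tuple R n.+1 (boxset n.+1 [set y | s - 1 <= y <= s]) =
  (iter n.+2 bdiff (tpow n.+1) s)%:E.
Proof.
pose mu := lebesgue_tuple R n.+1.
pose B := boxset n.+1 [set y | y <= s].
pose B1 := boxset n.+1 [set y | y <= s - 1].
pose B2 := boxset n.+1 [set y | s - 1 <= y <= s].
have mB1 : measurable B1 by apply: measurable_boxset; exact: measurable_le_set.
have mB2 : measurable B2.
  apply: measurable_boxset; rewrite (_ : mkset _ = `[s - 1, s]%classic).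
    exact: measurable_itv.
  by apply/seteqP; split => y; rewrite /= in_itv.
have BU : B = B1 `|` B2.
  apply/seteqP; split => t [].
  - move=> /= H1 H2; case: (leP (\sum_(i < n.+1) tnth t i) (s - 1)) => H3.
      by left.
    by right; split => //=; rewrite (ltW H3).
  - by move=> [/= H1 H2]; split => //=; apply: le_trans H2 _; rewrite gerBl.
  - by move=> [/= H1 /andP[_ H2]].
have BI : mu (B1 `&` B2) = 0%E.
  apply: (@subset_measure0 _ _ _ mu _ [set t | \sum_(i < n.+1) tnth t i = s - 1]).
  - exact: measurableI.
  - exact: (measurable_tuple_sum_preimage _ (f := id) (P := [set s - 1])).
  - by move=> t [[/= _ H1] [/= _ /andP[H2 _]]]; apply/eqP; rewrite eq_le H1.
  - exact: lebesgue_hyperplane.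
have muB2 : mu B2 \is a fin_num.
  rewrite ge0_fin_numE ?measure_ge0//; apply: (@le_lt_trans _ _ (mu B)).
    apply: le_measure; rewrite ?inE//; last by rewrite BU; exact: subsetUr.
    by apply: measurable_boxset; exact: measurable_le_set.
  by rewrite /mu lebesgue_boxset_le ltry.
have : mu B = (mu B1 + mu B2)%E.
  rewrite BU measureUfinl//= ?BI ?sube0//.
  by rewrite /mu lebesgue_boxset_le ltry.
rewrite /mu !lebesgue_boxset_le -/mu -(fineK muB2) -EFinD => muBE.
have e := EFin_inj muBE.
rewrite -/mu -/B2 -(fineK muB2); congr EFin.
rewrite -[RHS]/(iter n.+1 bdiff (tpow n.+1) s -
  iter n.+1 bdiff (tpow n.+1) (s - 1)).
by rewrite e addrAC subrr add0r.
Qed.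

End BoxVolume.
Arguments boxset {R} n P _.
Arguments symset {R} n P _.

(** * Facets of polyhedra and their volume *)

Section Facets.
Context {R : realType}.

Lemma dotp_mx d (x y : 'rV[R]_d) : dotp x y = (x *m y^T) 0 0.
Proof. by rewrite mxE; apply: eq_bigr => i _; rewrite mxE. Qed.

Lemma dotp_mxP d (x y : 'rV[R]_d) c : dotp x y = c <-> x *m y^T = c%:M.
Proof.
rewrite dotp_mx; split => [<-|->]; first by rewrite -mx11_scalar.
by rewrite mxE eqxx mulr1n.
Qed.

Lemma dotpC d (x y : 'rV[R]_d) : dotp x y = dotp y x.
Proof. by apply: eq_bigr => i _; rewrite mulrC. Qed.

Lemma dotpDr d (x y z : 'rV[R]_d) : dotp x (y + z) = dotp x y + dotp x z.
Proof. by rewrite !dotp_mx linearD/= mulmxDr mxE. Qed.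

Lemma dotpZr d a (x y : 'rV[R]_d) : dotp x (a *: y) = a * dotp x y.
Proof. by rewrite !dotp_mx linearZ/= -scalemxAr mxE. Qed.

Lemma dotpNr d (x y : 'rV[R]_d) : dotp x (- y) = - dotp x y.
Proof. by rewrite !dotp_mx linearN/= mulmxN mxE. Qed.

Lemma dotpBr d (x y z : 'rV[R]_d) : dotp x (y - z) = dotp x y - dotp x z.
Proof. by rewrite dotpDr dotpNr. Qed.

Lemma dotpDl d (x y z : 'rV[R]_d) : dotp (y + z) x = dotp y x + dotp z x.
Proof. by rewrite dotpC dotpDr !(dotpC x). Qed.

Lemma dotpZl d a (x y : 'rV[R]_d) : dotp (a *: y) x = a * dotp y x.
Proof. by rewrite dotpC dotpZr (dotpC x). Qed.

Lemma dotpNl d (x y : 'rV[R]_d) : dotp (- y) x = - dotp y x.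
Proof. by rewrite dotpC dotpNr dotpC. Qed.

Lemma dotp_sumr d m (x : 'rV[R]_d) (f : 'I_m -> 'rV[R]_d) :
  dotp x (\sum_(i < m) f i) = \sum_(i < m) dotp x (f i).
Proof.
rewrite dotp_mx linear_sum/= mulmx_sumr summxE.
by apply: eq_bigr => i _; rewrite dotp_mx.
Qed.

Lemma dotp_delta d (x : 'rV[R]_d) i : dotp (delta_mx 0 i) x = x 0 i.
Proof.
rewrite /dotp (bigD1 i)//= mxE !eqxx mul1r big1 ?addr0// => j ji.
by rewrite mxE (negbTE ji) mul0r.
Qed.

Lemma dotpxx_ge0 d (x : 'rV[R]_d) : 0 <= dotp x x.
Proof. by apply: sumr_ge0 => i _; rewrite -expr2 sqr_ge0. Qed.

Lemma dotpxx_eq0 d (x : 'rV[R]_d) : dotp x x = 0 -> x = 0.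
Proof.
move=> /eqP; rewrite psumr_eq0; last by move=> i _; rewrite -expr2 sqr_ge0.
move=> /allP x0; apply/rowP => i; rewrite mxE.
by have := x0 i (mem_index_enum i); rewrite mulf_eq0 orbb => /eqP.
Qed.

Lemma dotpxx_gt0 d (x : 'rV[R]_d) : x != 0 -> 0 < dotp x x.
Proof.
move=> x0; rewrite lt_neqAle dotpxx_ge0 andbT eq_sym.
by apply: contra x0 => /eqP xx; rewrite (dotpxx_eq0 xx).
Qed.

Lemma dotp_eq1_neq0 d (x y : 'rV[R]_d) : dotp x y = 1 -> x != 0.
Proof.
apply: contra_eq_neq => ->.
by rewrite dotp_mx mul0mx mxE eq_sym oner_eq0.
Qed.

Lemma polar_conv_hull d (A : set 'rV[R]_d) : polar (conv_hull A) = polar A.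
Proof.
apply/seteqP; split => y Py x.
  by move=> Ax; apply: Py; exact: sub_gen_smallest.
have cy : convex_set [set x : 'rV[R]_d | dotp x y <= 1].
  move=> u v l; rewrite !inE/= => uy vy.
  rewrite -[X in dotp X y]/(l%:num *: u + (1 - l%:num) *: v) dotpDl !dotpZl.
  have : 0 <= l%:num by exact: ge0.
  have : l%:num <= 1 by exact: le1.
  by nra.
by move/(_ _ (conj cy Py)).
Qed.

Lemma polarU d (A B : set 'rV[R]_d) : polar (A `|` B) = polar A `&` polar B.
Proof.
apply/seteqP; split => y.
  by move=> H; split => x Ax; apply: H; [left|right].
by move=> [HA HB] x []; [exact: HA|exact: HB].
Qed.

Lemma polar_rho d (k : R) : 0 < k ->
  polar (rho d k) = [set y | (forall i, `|y 0 i| <= 1) /\ \sum_(i < d) `|y 0 i| <= k].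
Proof.
move=> k0; rewrite /rho polar_conv_hull polarU /cross_polytope polar_conv_hull.
apply/seteqP; split => y [].
- move=> H1 H2; split.
    move=> i; rewrite ler_norml lerNl.
    have := H1 (delta_mx 0 i) (ex_intro _ i (or_introl erefl)).
    have := H1 (- delta_mx 0 i) (ex_intro _ i (or_intror erefl)).
    by rewrite dotpNl !dotp_delta => -> ->.
  (* The sign vector of [y] lies in the cube, and its pairing with [y] is the 1-norm. *)
  have := H2 (k^-1 *: \row_i Num.sg (y 0 i)).
  rewrite dotpZl mulrC ler_pdivrMr// mul1r.
  rewrite (_ : dotp _ _ = \sum_(i < d) `|y 0 i|).
    apply; exists (\row_i Num.sg (y 0 i)) => // i.
    by rewrite mxE normr_sg; case: (_ != 0).
  by apply: eq_bigr => i _; rewrite mxE normrEsg.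
- move=> H1 H2; split => x.
    move=> [i [->|->]]; rewrite ?dotpNl dotp_delta; have := H1 i;
      by rewrite ler_norml => /andP[]; lra.
  move=> [z cz <-]; rewrite dotpZl mulrC ler_pdivrMr// mul1r.
  apply: le_trans H2; apply: ler_sum => i _.
  apply: le_trans (ler_norm _) _; rewrite normrM ler_piMl//; exact: cz.
Qed.

Lemma mul_trmx_orth m d (U : 'M[R]_(m, d)) (n : 'rV[R]_d) :
  U *m n^T = 0 <-> forall i, dotp n (row i U) = 0.
Proof.
split => [Un i|Un].
  by rewrite dotpC dotp_mx -row_mul Un row0 mxE.
by apply/colP => i; have := Un i; rewrite dotpC dotp_mx -row_mul !mxE.
Qed.

Lemma submx_orth m d (U : 'M[R]_(m, d)) (n x : 'rV[R]_d) :
  U *m n^T = 0 -> (x <= U)%MS -> dotp n x = 0.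
Proof.
by move=> Un /submxP[t ->]; rewrite dotpC dotp_mx -mulmxA Un mulmx0 mxE.
Qed.

Lemma orth_submx m (U : 'M[R]_(m, m.+1)) (n x : 'rV[R]_m.+1) :
  row_free U -> U *m n^T = 0 -> n != 0 -> dotp n x = 0 -> (x <= U)%MS.
Proof.
move=> /eqP fU Un n0 nx.
have Uk : (U <= kermx n^T)%MS by apply/sub_kermxP.
have xk : (x <= kermx n^T)%MS.
  apply/sub_kermxP; rewrite -[RHS](raddf0 (@scalar_mx R 1)).
  by apply/dotp_mxP; rewrite dotpC.
apply: submx_trans xk _.
rewrite -(geq_leqif (mxrank_leqif_sup Uk)) mxrank_ker mxrank_tr fU.
by rewrite rank_rV n0 subn1.
Qed.

(** * Facets of a polyhedron given by irredundant constraints *)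

Section Polyhedron.
Context {J : finType} (m : nat) (D : pred J) (n p : J -> 'rV[R]_m.+1).
(** The point [p j] certifies that constraint [j] is irredundant: it is tight for [j] and strict for
    all the others. *)
Hypothesis np : forall j, D j -> dotp (n j) (p j) = 1.
Hypothesis np_lt : forall i j, D i -> D j -> i != j -> dotp (n i) (p j) < 1.

Let P := [set x : 'rV[R]_m.+1 | forall j, D j -> dotp (n j) x <= 1].
Let F j := P `&` [set x | dotp (n j) x = 1].

Lemma interior_step (L : finType) (v : L -> 'rV[R]_m.+1) (E : pred J)
    (c : 'rV[R]_m.+1) : (forall j, E j -> dotp (n j) c < 1) ->
  exists2 e : R, 0 < e & forall j l, E j ->
    dotp (n j) c + e * `|dotp (n j) (v l)| <= 1.
Proof.
(* [g j l] compares the variation along [v l] with the slack of constraint [j]; the sum of all these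
   ratios bounds each of them, which gives one step length for all. *)
move=> nc; pose g j l := `|dotp (n j) (v l)| / (1 - dotp (n j) c).
have g0 j l : E j -> 0 <= g j l.
  by move=> Ej; rewrite divr_ge0// subr_ge0 ltW// nc.
pose S := \sum_(j | E j) \sum_l g j l.
have S0 : 0 <= S by apply: sumr_ge0 => j Ej; apply: sumr_ge0 => l _; exact: g0.
exists (1 + S)^-1; first by rewrite invr_gt0; lra.
move=> j l Ej.
have gS : g j l <= S.
  rewrite /S (bigD1 j)//= (bigD1 l)//= -addrA lerDl addr_ge0//.
    by apply: sumr_ge0 => l' _; exact: g0.
  by apply: sumr_ge0 => j' /andP[Ej' _]; apply: sumr_ge0 => l' _; exact: g0.
rewrite -lerBrDl mulrC ler_pdivrMr; last by lra.
rewrite mulrC -ler_pdivrMr; last by rewrite subr_gt0 nc.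
by move: gS; rewrite /g; lra.
Qed.

(** The other constraints being strict at [p j], small multiples of the rows of [U], which are
    orthogonal to [n j], can be added to [p j] within the face. *)
Lemma polyhedron_affine_dim (U : 'M[R]_(m, m.+1)) j : D j -> row_free U ->
  U *m (n j)^T = 0 -> affine_dim (F j) m.
Proof.
move=> Dj fU Un.
have [|e e0 He] := @interior_step 'I_m (fun i => row i U)
  [pred i | D i && (i != j)] (p j).
  by move=> i /= /andP[Di ij]; exact: np_lt.
have Hn i : dotp (n j) (row i U) = 0 by move: i; apply/mul_trmx_orth.
have nj0 := dotp_eq1_neq0 (np Dj).
exists (p j), (e *: U); split.
- split => /=; last exact: np.
  by move=> i Di; have [->|ij] := eqVneq i j; [rewrite np|rewrite ltW// np_lt].
- by rewrite /row_free mxrank_scale_nz//; exact: lt0r_neq0.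
- move=> i; split => /=; last by rewrite linearZ/= dotpDr dotpZr Hn mulr0 addr0 np.
  move=> l Dl; rewrite linearZ/= dotpDr dotpZr.
  have [->|lj] := eqVneq l j; first by rewrite Hn mulr0 addr0 np.
  apply: le_trans (He l i _); last by rewrite /= Dl.
  by rewrite lerD2l ler_pM2l// ler_norm.
- move=> x [_ /= nx]; rewrite eqmx_scale ?gt_eqF//.
  by apply: orth_submx nj0 _ => //; rewrite dotpBr nx np// subrr.
Qed.

Lemma polyhedron_face_tight F' : is_face P F' -> affine_dim F' m ->
  exists2 j, D j & F' = F j.
Proof.
move=> [a [b [Pab eF]]] [q [U [Fq fU FU affU]]].
have aq : dotp a q = b by move: Fq; rewrite eF => -[].
have arow i : dotp a (row i U) = 0.
  have := FU i; rewrite eF => -[_ /=]; rewrite dotpDr aq => /eqP.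
  by rewrite addrC -subr_eq0 addrK => /eqP.
have nq i : D i -> dotp (n i) q <= 1 by move: Fq; rewrite eF => -[Pq _]; exact: Pq.
have nrow i l : D i -> dotp (n i) q + dotp (n i) (row l U) <= 1.
  by move=> Di; rewrite -dotpDr; have := FU l; rewrite eF => -[/(_ _ Di)].
(* The barycenter [c] of the affine basis lies on some constraint hyperplane. *)
pose u := \sum_(l < m) row l U.
pose c := q + m.+1%:R^-1 *: u.
have m0 : 0 < m.+1%:R^-1 :> R by rewrite invr_gt0 ltr0n.
have nc i : m.+1%:R * dotp (n i) c = dotp (n i) q +
    \sum_(l < m) (dotp (n i) q + dotp (n i) (row l U)).
  rewrite dotpDr dotpZr mulrDr mulVKf ?pnatr_eq0// big_split/= sumr_const card_ord.
  by rewrite addrA -mulrS mulr_natl dotp_sumr.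
have uU : (u <= U)%MS by apply: summx_sub => l _; exact: row_sub.
have ac : dotp a c = b.
  rewrite dotpDr aq dotpZr (submx_orth _ uU) ?mulr0 ?addr0//.
  exact/mul_trmx_orth.
have Pc : P c.
  move=> i Di; rewrite -(ler_pM2l (_ : 0 < m.+1%:R)) ?ltr0n// mulr1 nc.
  rewrite mulrSr addrC lerD ?nq//.
  rewrite -[X in _ <= X%:R]card_ord -sumr_const; apply: ler_sum => l _.
  exact: nrow.
have [[j [Dj ncj]]|ntight] := pselect (exists j, D j /\ dotp (n j) c = 1); last first.
  (* If all constraints were strict at [c], it could be moved both ways along some [w] orthogonal to
     the flat. The supporting inequality at both points gives [dotp a w = 0], so the moved point
     stays in the face and [w] is in the direction of the flat: a nonzero vector orthogonal to
     itself. *)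
  have [w w0 wU] : exists2 w : 'rV[R]_m.+1, w != 0 & w *m U^T = 0.
    have /rowV0Pn[w] : kermx U^T != 0.
      rewrite -mxrank_eq0 mxrank_ker mxrank_tr (eqP fU) subSnn//.
    by move=> /sub_kermxP wU w0; exists w.
  have [|e e0 He] := @interior_step 'I_1 (fun=> w) D c.
    move=> j Dj; rewrite lt_neqAle Pc// andbT; apply/eqP => ncj.
    by apply: ntight; exists j.
  have Pe (s : R) : `|s| = e -> P (c + s *: w).
    move=> se j Dj; rewrite dotpDr dotpZr; apply: le_trans (He j ord0 Dj).
    by rewrite lerD2l -se -normrM ler_norm.
  have aw : dotp a w = 0.
    have := Pab _ (Pe e (gtr0_norm e0)); have := Pab _ (Pe (- e) _).
    rewrite normrN gtr0_norm// => /(_ erefl).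
    rewrite !(dotpDr a c) !dotpZr ac => H1 H2; nra.
  have Fe : F' (c + e *: w).
    rewrite eF; split; first by apply: Pe; rewrite gtr0_norm.
    by rewrite /= (dotpDr a c) dotpZr aw mulr0 addr0.
  have wsubU : (w <= U)%MS.
    rewrite -(eqmx_scale w (lt0r_neq0 e0)).
    have -> : e *: w = (c + e *: w - q) - m.+1%:R^-1 *: u.
      by rewrite -[RHS]addrA -opprD -/c [c + _]addrC addrK.
    by apply: addmx_sub; [exact: affU|rewrite eqmx_opp; exact: scalemx_sub].
  have Uw : U *m w^T = 0 by rewrite -[U]trmxK -trmx_mul wU trmx0.
  by move: w0; rewrite (dotpxx_eq0 (submx_orth Uw wsubU)) eqxx.
(* The value 1 at [c] is the mean of [m.+1] values that are at most 1, so each of them is 1. *)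
have nqj : dotp (n j) q = 1.
  apply/eqP; rewrite eq_le nq//= leNgt; apply/negP => nq1.
  have := nc j; rewrite ncj mulr1 => /eqP; rewrite gt_eqF//.
  rewrite mulrSr addrC ler_ltD// -[X in _ <= X%:R]card_ord -sumr_const.
  by apply: ler_sum => l _; exact: nrow.
have njrow : U *m (n j)^T = 0.
  apply/mul_trmx_orth.
  have : \sum_(l < m) - dotp (n j) (row l U) == 0.
    have := nc j; rewrite ncj mulr1 nqj big_split/= sumr_const card_ord mulrSr.
    by rewrite sumrN => nj; apply/eqP; lra.
  rewrite psumr_eq0; last first.
    by move=> l _; have := nrow j l Dj; rewrite nqj; lra.
  by move=> /allP H l; have := H l (mem_index_enum l); rewrite oppr_eq0 => /eqP.
have nj0 := dotp_eq1_neq0 nqj.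
exists j => //; apply/seteqP; split => x.
  move=> Fx; split; first by move: Fx; rewrite eF => -[].
  have := submx_orth njrow (affU _ Fx).
  by rewrite /= dotpBr nqj => /eqP; rewrite subr_eq0 => /eqP.
move=> [Px /= nx]; rewrite eF; split => //=.
have : (x - q <= U)%MS by apply: orth_submx nj0 _ => //; rewrite dotpBr nx nqj subrr.
have Ua : U *m a^T = 0 by apply/mul_trmx_orth.
move=> /(submx_orth Ua); rewrite dotpBr aq => /eqP.
by rewrite subr_eq0 => /eqP.
Qed.

Lemma facets_polyhedron
    (U : forall j, D j ->
       exists U : 'M[R]_(m, m.+1), row_free U /\ U *m (n j)^T = 0) :
  facets P = F @` [set j | D j].
Proof.
apply/seteqP; split => F' /=.
  by move=> [fF' dF']; have [j Dj ->] := polyhedron_face_tight fF' dF'; exists j.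
move=> [j Dj <-]; split.
  by exists (n j), 1; split => // x Px; exact: Px.
by have [V [fV Vn]] := U _ Dj; exact: polyhedron_affine_dim Vn.
Qed.

(** [p j] lies in [F j] and in no other face of the family. This permits reindexing a sum over
    facets, which are sets, by constraints. *)
Lemma polyhedron_face_inj : set_inj [set j | D j] F.
Proof.
move=> i j; rewrite !inE/= => Di Dj Fij; apply/eqP; apply: contraT => ij.
have : F j (p j).
  split; last exact: np.
  by move=> l Dl; have [->|lj] := eqVneq l j; [rewrite np|rewrite ltW// np_lt].
by rewrite -Fij => -[_ /= npij]; have := np_lt Di Dj ij; rewrite npij ltxx.
Qed.

End Polyhedron.

(** * Isometric charts of hyperplanes *)

Lemma orthonormal_row_free m d (U : 'M[R]_(m, d)) : U *m U^T = 1%:M -> row_free U.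
Proof. by move=> UU; apply/row_freeP; exists U^T. Qed.

(** Supplies the isometric charts of a hyperplane as well as the free families of directions that
    [facets_polyhedron] asks for. *)
Lemma orthonormal_complement m (n : 'rV[R]_m.+1) : n != 0 ->
  exists U : 'M[R]_(m, m.+1), U *m U^T = 1%:M /\ U *m n^T = 0.
Proof.
move=> n0.
have nn0 := dotpxx_gt0 n0.
pose u := (Num.sqrt (dotp n n))^-1 *: n.
have uu : dotp u u = 1.
  by rewrite dotpZl dotpZr mulrA -invfM -expr2 sqr_sqrtr ?mulVf ?gt_eqF// ltW.
have nu : n = Num.sqrt (dotp n n) *: u.
  by rewrite scalerA divff ?scale1r// gt_eqF// sqrtr_gt0.
clearbody u.
suff [H HH uH] : exists2 H : 'M[R]_(1 + m), H *m H^T = 1%:M & usubmx H = u.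
  move: HH; rewrite -{1 2}[H]vsubmxK tr_col_mx mul_col_row (scalar_mx_block 1 m 1) uH.
  move=> /eq_block_mx[_ _ Hu HH]; exists (dsubmx H); split => //.
  by rewrite nu linearZ/= -scalemxAr Hu scaler0.
(* Householder reflection exchanging [u] and the first basis vector. *)
pose e : 'rV[R]_(1 + m) := delta_mx 0 0.
(* The reflection divides by [s], which vanishes when [u = e]. *)
have [ue|ue] := eqVneq u e.
  exists 1%:M; first by rewrite trmx1 mulmx1.
  rewrite ue; apply/matrixP => i j; rewrite !mxE !ord1/= eq_sym.
  by congr (_ == _)%:R; exact: val_inj.
pose v := u - e; pose s := dotp v v.
have ee : dotp e e = 1 by rewrite dotp_delta mxE.
have s0 : s != 0.
  by apply/eqP => /dotpxx_eq0/eqP; rewrite subr_eq0 (negbTE ue).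
have sE : s = 2 * (1 - dotp u e).
  by rewrite /s /v dotpBr !(dotpC (u - e)) !dotpBr uu ee (dotpC e u); ring.
pose N := v^T *m v.
have NN : N *m N = s *: N.
  rewrite /N -mulmxA (mulmxA v) (iffLR (dotp_mxP v v s) erefl).
  by rewrite mul_scalar_mx -scalemxAr.
exists (1%:M - (2 / s) *: N).
  have NT : N^T = N by rewrite /N trmx_mul trmxK.
  have HT : (1%:M - (2 / s) *: N)^T = 1%:M - (2 / s) *: N.
    by rewrite raddfB/= trmx1; congr (_ - _); rewrite [LHS]linearZ/= NT.
  rewrite HT.
  rewrite mulmxBl mul1mx mulmxBr mulmx1 -scalemxAl -scalemxAr NN !scalerA.
  have -> : 2 / s * (2 / s) * s = 2 / s + 2 / s by field.
  by rewrite scalerDl opprB addrK subrK.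
(* Since [dotp e v = - s / 2], the reflection sends [e] to [e + v = u], which is its first row. *)
have u0 : u 0 0 = 1 - s / 2 by rewrite -(dotp_delta u) -/e dotpC sE; field.
apply/rowP => j; rewrite mxE [lshift m 0](_ : _ = 0 :> 'I_m.+1); last exact: val_inj.
rewrite !mxE big_ord1 !mxE eqxx (eq_sym 0 j) -[u ord0 0]/(u 0 0) u0 /=.
by case: (j == 0); rewrite /=; field.
Qed.

(** The affine hull of [A] and the range of the chart are nested flats of the same dimension [m],
    hence equal. *)
Lemma chart_orth m (n p : 'rV[R]_m.+1) (U : 'M[R]_(m, m.+1)) (A : set 'rV[R]_m.+1) :
  affine_dim A m -> (forall x, A x -> dotp n x = 1) ->
  U *m U^T = 1%:M -> A `<=` range (chart p U) ->
  U *m n^T = 0 /\ dotp n p = 1.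
Proof.
move=> [q [W [Aq fW AW affW]]] An UU AU.
have WU : (W <= U)%MS.
  apply/row_subP => i.
  have [t _ et] := AU _ Aq; have [s _ es] := AU _ (AW i).
  have -> : row i W = \row_(i < m) tnth s i *m U - \row_(i < m) tnth t i *m U.
    have : row i W = chart p U s - chart p U t by rewrite es et addrC addKr.
    by move=> ->; rewrite /chart opprD addrACA subrr add0r.
  by rewrite -mulmxBl submxMl.
have UW : (U <= W)%MS.
  rewrite -(geq_leqif (mxrank_leqif_sup WU)).
  by rewrite (eqP fW) (eqP (orthonormal_row_free UU)).
have Wn : W *m n^T = 0.
  apply/mul_trmx_orth => i; have := An _ (AW i).
  by rewrite dotpDr An// => /eqP; rewrite addrC -subr_eq0 addrK => /eqP.
have Un : U *m n^T = 0 by move/submxP: UW => [t ->]; rewrite -mulmxA Wn mulmx0.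
split => //; have [t _ et] := AU _ Aq.
by rewrite -(An _ Aq) -et /chart dotpDr (submx_orth Un (submxMl _ U)) addr0.
Qed.

(* The square matrix with rows [n] and [U] has [n^T / (n n^T)] as first column of
   its inverse; compare with the adjugate. *)
Lemma norm_det_col' m (n : 'rV[R]_m.+1) (U : 'M[R]_(m, m.+1)) i : n != 0 ->
  U *m U^T = 1%:M -> U *m n^T = 0 ->
  `|\det (col' i U)| = `|n 0 i| / Num.sqrt (dotp n n).
Proof.
move=> n0 UU Un.
have nn0 := dotpxx_gt0 n0.
pose M : 'M[R]_(1 + m) := col_mx n U.
pose N : 'M[R]_(1 + m) := row_mx ((dotp n n)^-1 *: n^T) U^T.
have nnM : n *m n^T = (dotp n n)%:M by apply/dotp_mxP.
have MN : M *m N = 1%:M.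
  rewrite mul_col_row -!scalemxAr UU Un scaler0 nnM scale_scalar_mx mulVf ?gt_eqF//.
  have -> : n *m U^T = 0 by rewrite -[n]trmxK -trmx_mul Un trmx0.
  by rewrite -scalar_mx_block.
have detM2 : \det M ^+ 2 = dotp n n.
  rewrite expr2 -{2}det_tr -det_mulmx tr_col_mx mul_col_row UU Un nnM.
  by rewrite det_ublock det1 mulr1 det_scalar expr1.
have detM : `|\det M| = Num.sqrt (dotp n n) by rewrite -detM2 sqrtr_sqr.
have uM : M \in unitmx by have [] := mulmx1_unit MN.
have NE : N = invmx M by rewrite -[LHS]mul1mx -(mulVmx uM) -mulmxA MN mulmx1.
have cofE : `|cofactor M 0 i| = `|\det (col' i U)|.
  rewrite /cofactor normrM normrX normrN1 expr1n mul1r; congr `|\det _|.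
  apply/matrixP => a b; rewrite [LHS]mxE [LHS]mxE [RHS]mxE.
  rewrite (_ : lift 0 a = rshift 1 a); last exact: val_inj.
  by rewrite col_mxEd.
have : N i 0 = (\det M)^-1 * cofactor M 0 i.
  by rewrite NE /invmx uM !mxE.
rewrite (_ : N i 0 = (dotp n n)^-1 * n 0 i); last first.
  transitivity (N i (lshift m 0)); first by congr (N i _); exact: val_inj.
  by rewrite row_mxEl !mxE.
move=> /(congr1 (fun x => `|x|)).
rewrite normrM normfV [RHS]normrM normfV cofE detM => e.
have S0 : Num.sqrt (dotp n n) != 0 by rewrite gt_eqF// sqrtr_gt0.
apply: (mulfI (invr_neq0 S0)); rewrite -e.
rewrite (ger0_norm (ltW nn0)) -[in LHS](sqr_sqrtr (ltW nn0)).
by field.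
Qed.

End Facets.

Lemma rowt_mktuple (R : realType) m (f : 'I_m -> R) :
  rowt [tuple f j | j < m] = \row_j f j.
Proof. by apply/rowP => j; rewrite !mxE tnth_mktuple. Qed.

(** A chart followed by forgetting coordinate [i] is an affine bijection whose determinant involves
    only [n] and [i]. So the set given to [xget] is a singleton, and nonempty because [n] has an
    orthonormal complement. *)
Lemma flat_volume_hyperplane (R : realType) m (n : 'rV[R]_m.+1) (i : 'I_m.+1)
    (A : set 'rV[R]_m.+1) (B : set (m.-tuple (measurableTypeR R))) :
  n 0 i != 0 -> measurable B -> affine_dim A m ->
  (forall x, A x -> dotp n x = 1) ->
  (forall x, dotp n x = 1 -> (A x <-> B [tuple x 0 (lift i j) | j < m])) ->
  flat_volume m A = ((Num.sqrt (dotp n n) / `|n 0 i|)%:E * lebesgue_tuple R m B)%E.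
Proof.
move=> ni mB dA An AB.
have n0 : n != 0 by apply: contraNneq ni => ->; rewrite mxE.
have nn0 := dotpxx_gt0 n0.
have S0 : 0 < Num.sqrt (dotp n n) by rewrite sqrtr_gt0.
have chartE (p : 'rV[R]_m.+1) (U : 'M[R]_(m, m.+1)) :
    U *m U^T = 1%:M -> A `<=` range (chart p U) ->
    lebesgue_tuple R m (chart p U @^-1` A) =
    ((Num.sqrt (dotp n n) / `|n 0 i|)%:E * lebesgue_tuple R m B)%E.
  move=> UU AU; have [Un np] := chart_orth dA An UU AU.
  have detU := norm_det_col' i n0 UU Un.
  have uU : col' i U \in unitmx.
    rewrite unitmxE unitfE -normr_eq0 detU mulf_neq0// ?normr_eq0//.
    by rewrite invr_eq0 gt_eqF.
  rewrite (@scales_volume_unitmx R m _ uU (col' i p) B mB) detU muleA -EFinM.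
  have -> : Num.sqrt (dotp n n) / `|n 0 i| * (`|n 0 i| / Num.sqrt (dotp n n)) = 1.
    by field; rewrite gt_eqF// normr_eq0 ni.
  rewrite mul1e; congr (lebesgue_tuple R m _); apply/seteqP.
  have nc t : dotp n (chart p U t) = 1.
    by rewrite /chart dotpDr np (submx_orth Un (submxMl _ U)) addr0.
  have tE t : [tuple chart p U t 0 (lift i j) | j < m] = affmap (col' i p) (col' i U) t.
    apply: rowt_inj; rewrite rowt_affmap rowt_mktuple.
    apply/rowP => j; rewrite !mxE; congr +%R.
    by apply: eq_bigr => l _; rewrite !mxE.
  split => t /=; rewrite -tE; by apply AB.
have [U [UU Un]] := orthonormal_complement n0.
have [q Aq] : exists q, A q by have [q [W [Aq]]] := dA; exists q.
have AU : A `<=` range (chart q U).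
  move=> x Ax.
  have /submxP[t et] : (x - q <= U)%MS.
    apply: (orth_submx (orthonormal_row_free UU) Un n0).
    by rewrite dotpBr !An// subrr.
  exists [tuple t 0 j | j < m] => //; rewrite /chart -/(rowt _) rowt_mktuple.
  rewrite (_ : \row_j t 0 j = t); last by apply/rowP => j; rewrite mxE.
  by rewrite -et addrC subrK.
apply: xget_subset1.
  by exists q, U; split; rewrite ?chartE.
by move=> v w [p [V [VV AV ->]]] [p' [V' [VV' AV' ->]]]; rewrite !chartE.
Qed.

Lemma esum_finType (R : realType) (J : finType) (D : pred J) (f : J -> \bar R) :
  (forall j, D j -> (0 <= f j)%E) ->
  \esum_(j in [set j | D j]) f j = (\sum_(j | D j) f j)%E.
Proof.
move=> f0; rewrite esum_fset//=; last by move=> j; rewrite inE => /f0.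
rewrite (_ : [set j | D j] = [set` enum D]); last first.
  by apply/seteqP; split => j /=; rewrite mem_enum.
by rewrite -fsbig_seq ?enum_uniq// big_enum.
Qed.

(** Terms with [s < i] have zero positive part. The floors in the theorem arise here, as [K] for
    [s = k - 1] and [s = k]. *)
Lemma bdiff_tpow_trunc (R : realType) N n K (s : R) : (K <= N.+1)%N ->
  (forall i, (i < K)%N = (i%:R <= s)) ->
  iter N bdiff (tpow n) s =
  \sum_(0 <= i < K) (-1) ^+ i * 'C(N, i)%:R * ((s - i%:R) ^+ n / n`!%:R).
Proof.
move=> KN Ks; rewrite iter_bdiff (big_nat_widen _ _ _ _ _ KN) [RHS]big_mkcond/=.
apply: eq_bigr => i _; rewrite /tpow subr_ge0 Ks.
by case: ifP => _; rewrite ?mulr0.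
Qed.

(** * The facets of the polar of [rho] and their volumes *)

Section Facets_rho.
Context {R : realType} (m : nat) (k : R).
Hypotheses (k1 : 1 <= k) (kd : k <= m.+1%:R).

Let J := (('I_m.+1 * bool) + {ffun 'I_m.+1 -> bool})%type.

(** Normals are scaled to make every right-hand side 1: [inl (i, b)] bounds a signed coordinate by
    1, and [inr e] bounds a signed sum by [k]. *)
Definition rho_normal (j : J) : 'rV[R]_m.+1 :=
  match j with
  | inl (i, b) => (-1) ^+ b *: delta_mx 0 i
  | inr e => k^-1 *: \row_i (-1) ^+ e i
  end.

(** The barycenters of the facets, used as irredundancy certificates. *)
Definition rho_center (j : J) : 'rV[R]_m.+1 :=
  match j with
  | inl (i, b) => (-1) ^+ b *: delta_mx 0 i
  | inr e => (k / m.+1%:R) *: \row_i (-1) ^+ e i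
  end.

(* Only the nonredundant constraints: when [k = d] the sign constraints follow
   from the coordinate ones, and conversely when [k = 1 < d]. *)
Definition rho_facet : pred J := fun j =>
  match j with
  | inl _ => (1 < k) || (m == 0)%N
  | inr _ => k < m.+1%:R
  end.

Let P := [set x : 'rV[R]_m.+1 | forall j, rho_facet j -> dotp (rho_normal j) x <= 1].
Let F j := P `&` [set x | dotp (rho_normal j) x = 1].

Let k0 : 0 < k. Proof. exact: lt_le_trans ltr01 k1. Qed.

Lemma dotp_inl i b (x : 'rV[R]_m.+1) :
  dotp (rho_normal (inl (i, b))) x = (-1) ^+ b * x 0 i.
Proof. by rewrite dotpZl dotp_delta. Qed.

Lemma dotp_inr e (x : 'rV[R]_m.+1) :
  dotp (rho_normal (inr e)) x = k^-1 * \sum_i (-1) ^+ e i * x 0 i.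
Proof.
by rewrite dotpZl; congr (_ * _); apply: eq_bigr => i _; rewrite mxE.
Qed.

Lemma rho_normal_center j : dotp (rho_normal j) (rho_center j) = 1.
Proof.
case: j => [[i b]|e].
  by rewrite dotp_inl !mxE !eqxx mulr1 -expr2 sqrr_sign.
rewrite dotp_inr; under eq_bigr do rewrite !mxE mulrCA -expr2 sqrr_sign mulr1.
rewrite sumr_const card_ord -[_ / _ *+ _]mulr_natr.
by rewrite divfK ?mulVf ?pnatr_eq0 ?lt0r_neq0.
Qed.

(** The pairing is 0 or -1 between coordinate constraints, at most [k / d] or [1 / k] in absolute
    value between the two kinds, and below 1 between sign vectors that differ somewhere. *)
Lemma rho_normal_center_lt i j : rho_facet i -> rho_facet j -> i != j ->
  dotp (rho_normal i) (rho_center j) < 1.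
Proof.
have kd1 : k < m.+1%:R -> k / m.+1%:R < 1.
  by rewrite ltr_pdivrMr ?ltr0n// mul1r.
have kd0 : 0 <= k / m.+1%:R by rewrite divr_ge0// ltW.
case: i j => [[i b]|e] [[j c]|f] Di Dj ij.
- rewrite dotp_inl !mxE eqxx/=; have [eij|] := eqVneq i j; last by rewrite !mulr0.
  move: ij {Di Dj}; rewrite {}eij; case: b c => -[]; rewrite ?eqxx//= => _;
    rewrite !(expr0, expr1, mulr1, mul1r); lra.
- rewrite dotp_inl !mxE; apply: le_lt_trans (kd1 Dj).
  apply: le_trans (ler_norm _) _.
  by rewrite normrMsign normrM normr_sign mulr1 ger0_norm.
- rewrite dotp_inr (bigD1 j)//= big1 ?addr0; last first.
    by move=> l lj; rewrite !mxE (negbTE lj) !mulr0.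
  rewrite !mxE !eqxx mulr1 mulrC ltr_pdivrMr// mul1r.
  apply: (@le_lt_trans _ _ 1).
    by apply: le_trans (ler_norm _) _; rewrite normrMsign normr_sign.
  by case/orP: Dj => // /eqP m0; move: Di; rewrite /rho_facet m0 ltNge k1.
- have [l el] : exists l, e l != f l.
    apply/existsP; rewrite -negb_forall; apply: contra ij => /forallP ef.
    by apply/eqP; congr inr; apply/ffunP => l; apply/eqP.
  rewrite dotp_inr; under eq_bigr do rewrite mxE mulrCA.
  rewrite -mulr_sumr mulrA mulKf ?lt0r_neq0//.
  rewrite mulrC ltr_pdivrMr ?ltr0n// mul1r (bigD1 l)//= mxE.
  have -> : (-1) ^+ e l * (-1) ^+ f l = -1 :> R.
    by move: el; case: (e l) (f l) => -[]//= _; rewrite ?expr0 ?expr1 ?mulr1 ?mul1r.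
  apply: (@lt_le_trans _ _ (\sum_(i < m.+1) 1)); last by rewrite sumr_const card_ord.
  rewrite [X in _ < X](bigD1 l)//= ltr_leD//.
  apply: ler_sum => i _; apply: le_trans (ler_norm _) _.
  by rewrite normrMsign mxE normr_sign.
Qed.

(** Dropped constraints are recovered: at [k = d] by adding up the coordinate bounds, at [k = 1]
    because each coordinate is bounded by the 1-norm. *)
Lemma polar_rho_polyhedron : polar (rho m.+1 k) = P.
Proof.
rewrite polar_rho//; apply/seteqP; split => x.
  move=> [x1 xk] [[i b]|e] _.
    rewrite dotp_inl; apply: le_trans (ler_norm _) _; rewrite normrMsign; exact: x1.
  rewrite dotp_inr mulrC ler_pdivrMr// mul1r; apply: le_trans xk.
  by apply: ler_sum => i _; apply: le_trans (ler_norm _) _; rewrite normrMsign.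
move=> Px.
have x1 : (1 < k) || (m == 0)%N -> forall i, `|x 0 i| <= 1.
  move=> kD i; rewrite ler_norml lerNl.
  have := Px (inl (i, false)) kD; have := Px (inl (i, true)) kD.
  by rewrite !dotp_inl expr1 expr0 mulN1r mul1r => -> ->.
have xk : \sum_(i < m.+1) `|x 0 i| <= k.
  move: kd; rewrite le_eqVlt => /predU1P[keq|klt].
    rewrite keq -[X in _ <= X%:R]card_ord -sumr_const; apply: ler_sum => i _.
    apply: x1; by rewrite keq ltr1n ltnS lt0n orNb.
  have := Px (inr [ffun i => x 0 i < 0]) klt.
  rewrite dotp_inr mulrC ler_pdivrMr// mul1r; congr (_ <= _).
  by apply: eq_bigr => i _; rewrite ffunE -normrEsign.
split => // i; move: k1; rewrite le_eqVlt => /predU1P[keq|klt].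
  2: by apply: x1; rewrite klt.
apply: le_trans (_ : \sum_(i < m.+1) `|x 0 i| <= 1); last by rewrite keq.
by rewrite (bigD1 i)//= lerDl sumr_ge0.
Qed.

Lemma rho_normal_neq0 j : rho_normal j != 0.
Proof. exact: dotp_eq1_neq0 (rho_normal_center j). Qed.

Lemma facets_polar_rho : facets (polar (rho m.+1 k)) = F @` [set j | rho_facet j].
Proof.
rewrite polar_rho_polyhedron; apply: facets_polyhedron.
- by move=> j _; exact: rho_normal_center.
- exact: rho_normal_center_lt.
- move=> j _; have [U [UU Un]] := orthonormal_complement (rho_normal_neq0 j).
  by exists U; split => //; exact: orthonormal_row_free.
Qed.

Lemma facet_affine_dim j : rho_facet j -> affine_dim (F j) m.
Proof.
by move=> Dj; have : (F @` [set j | rho_facet j]) (F j) by [exists j];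
  rewrite -facets_polar_rho => -[].
Qed.

Lemma facet_inl_volume i b : rho_facet (inl (i, b)) ->
  flat_volume m (F (inl (i, b))) = (2 ^+ m * iter m bdiff (tpow m) (k - 1))%:E.
Proof.
move=> Dj; have mle : measurable [set y : measurableTypeR R | y <= k - 1].
  exact: measurable_le_set.
rewrite (@flat_volume_hyperplane _ _ (rho_normal (inl (i, b))) i _
   (symset m [set y | y <= k - 1])).
- rewrite (_ : dotp _ _ = 1); last exact: (rho_normal_center (inl (i, b))).
  rewrite !mxE !eqxx mulr1 normr_sign divr1 sqrtr1 mul1e.
  by rewrite lebesgue_symset_boxset// lebesgue_boxset_le EFinM.
- by rewrite !mxE !eqxx mulr1 signr_eq0.
- exact: measurable_symset.
- exact: facet_affine_dim.
- by move=> x [].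
- move=> x nx; have xi : `|x 0 i| = 1.
    by rewrite -(normrMsign b) -dotp_inl nx normr1.
  have sumx : \sum_(l < m.+1) `|x 0 l| =
      1 + \sum_(j < m) `|tnth [tuple x 0 (lift i j) | j < m] j|.
    rewrite (bigD1_ord i)//= xi; congr +%R.
    by apply: eq_bigr => l _; rewrite tnth_mktuple.
  rewrite /F -polar_rho_polyhedron polar_rho//; split.
    move=> [[x1 xk] _]; split; first by move=> l; rewrite tnth_mktuple.
    by move: xk; rewrite sumx /=; lra.
  move=> [x1 xk]; split => //; split; last by rewrite sumx; move: xk => /=; lra.
  move=> l; have [l' ->|->] := unliftP i l; last by rewrite xi.
  by have := x1 l'; rewrite tnth_mktuple.
Qed.

(** On the hyperplane the forgotten coordinate is [k] minus the signed sum of the others, so its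
    bounds 0 and 1 become the slab condition. *)
Lemma facet_inr_volume e : rho_facet (inr e) ->
  flat_volume m (F (inr e)) =
  (Num.sqrt m.+1%:R * iter m.+1 bdiff (tpow m) k)%:E.
Proof.
move=> Dj.
pose slab := boxset m [set y : R | k - 1 <= y <= k].
have mslab : measurable slab.
  apply: measurable_boxset; rewrite (_ : mkset _ = `[k - 1, k]%classic).
    exact: measurable_itv.
  by apply/seteqP; split => y; rewrite /= in_itv.
(* Here [1 <= k < m.+1], so [m] is positive, as the slab formula requires. *)
have [m' em] : exists m', m = m'.+1.
  have km : k < m.+1%:R := Dj.
  exists m.-1; rewrite prednK// lt0n; apply: contraTneq km => ->.
  by rewrite -leNgt.
have slabE : lebesgue_tuple R m slab = (iter m.+1 bdiff (tpow m) k)%:E.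
  rewrite /slab em; exact: lebesgue_boxset_slab.
pose S : 'M[R]_m := diag_mx (\row_j (-1) ^+ e (lift 0 j)).
have detS : `|\det S| = 1.
  by rewrite det_diag normr_prod big1// => j _; rewrite mxE normr_sign.
have uS : S \in unitmx by rewrite unitmxE unitfE -normr_eq0 detS oner_eq0.
have SE t : [tuple (-1) ^+ e (lift 0 j) * tnth t j | j < m] = affmap 0 S t.
  apply: rowt_inj; rewrite rowt_affmap rowt_mktuple add0r mul_mx_diag.
  by apply/rowP => j; rewrite !mxE mulrC.
rewrite (@flat_volume_hyperplane _ _ (rho_normal (inr e)) 0 _
   (affmap 0 S @^-1` slab)).
- have := @scales_volume_unitmx R m S uS 0 slab mslab.
  rewrite detS mul1e slabE => <-; rewrite -EFinM; congr (_ * _)%:E.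
  (* The normal has norm [Num.sqrt m.+1%:R / k] and entries of absolute value [1 / k]: the origin of
     the factor [Num.sqrt d]. *)
  rewrite dotp_inr; under eq_bigr do rewrite !mxE mulrCA -expr2 sqrr_sign mulr1.
  rewrite sumr_const card_ord -[_ *+ _]mulr_natl mulrCA -expr2.
  rewrite sqrtrM ?ler0n// sqrtr_sqr mxE normrM mxE normr_sign mulr1.
  by rewrite mulfK// normr_eq0 invr_eq0 lt0r_neq0.
- by rewrite !mxE mulf_neq0 ?signr_eq0// invr_eq0 lt0r_neq0.
- exact: measurable_preimage_affmap.
- exact: facet_affine_dim.
- by move=> x [].
move=> x nx; have {nx} nk : \sum_(l < m.+1) (-1) ^+ e l * x 0 l = k.
  by move: nx; rewrite dotp_inr => /(canRL (mulVKf (lt0r_neq0 k0))); rewrite mulr1.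
pose y l := (-1) ^+ e l * x 0 l.
have xy l : `|x 0 l| = `|y l| by rewrite /y normrMsign.
have sumy : y 0 + \sum_(j < m) y (lift 0 j) = k by rewrite -nk big_ord_recl.
have slabP : (affmap 0 S @^-1` slab) [tuple x 0 (lift 0 j) | j < m] <->
    (forall j : 'I_m, 0 <= y (lift 0 j) <= 1) /\ k - 1 <= k - y 0 <= k.
  rewrite /= -SE /slab /boxset/=.
  have -> : \sum_(i < m) tnth [tuple (-1) ^+ e (lift 0 j) *
     tnth [tuple x 0 (lift 0 j0) | j0 < m] j | j < m] i = k - y 0.
    rewrite -sumy addrAC subrr add0r; apply: eq_bigr => j _.
    by rewrite !tnth_mktuple.
  by split => -[H1 H2]; split => // j; have := H1 j; rewrite !tnth_mktuple.
apply: (iff_trans _ (iff_sym slabP)).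
rewrite /F -polar_rho_polyhedron polar_rho//; split.
  move=> [[x1 xk] _].
  (* The signed sum equals [k] and the 1-norm is at most [k], so the nonnegative gaps between their
     terms vanish. *)
  have yx l : y l = `|x 0 l|.
    have : \sum_(l < m.+1) (`|x 0 l| - y l) == 0.
      rewrite sumrB nk eq_le subr_le0 xk subr_ge0 -[X in X <= _]nk.
      by apply: ler_sum => i _; rewrite xy ler_norm.
    rewrite psumr_eq0; last by move=> i _; rewrite subr_ge0 xy ler_norm.
    move=> /allP /(_ l (mem_index_enum l)).
    by rewrite subr_eq0 => /eqP.
  split; first by move=> j; rewrite yx normr_ge0 x1.
  by have := x1 0; have := normr_ge0 (x 0 0); rewrite -yx; lra.
move=> [y1 y0]; have y01 l : 0 <= y l <= 1.
  by have [l' ->|->] := unliftP 0 l; [exact: y1|lra].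
have yx l : `|x 0 l| = y l by rewrite xy ger0_norm//; have /andP[] := y01 l.
split; last by rewrite /= dotp_inr nk mulVf ?lt0r_neq0.
split; first by move=> l; rewrite yx; have /andP[] := y01 l.
by under eq_bigr do rewrite yx; rewrite nk.
Qed.

End Facets_rho.

(** * Assembly of the formula *)

Lemma flat_volume_ge0 (R : realType) d m (A : set 'rV[R]_d) : (0 <= flat_volume m A)%E.
Proof.
rewrite /flat_volume; case: xgetP => [v -> [p [U [_ _ ->]]]|_]; last by [].
exact: measure_ge0.
Qed.

(** At [k = d] the slab meets the cube only where the sum is maximal, inside a null hyperplane;
    dimension 0 is computed directly. *)
Lemma bdiff_tpow_slab_max (R : realType) m : iter m.+1 bdiff (tpow m) m.+1%:R = 0 :> R.
Proof.
case: m => [|m].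
  by rewrite /= /bdiff /tpow subrr ler01 lexx expr0 subrr.
apply: EFin_inj; rewrite -lebesgue_boxset_slab.
set B := boxset _ _.
have BH : B `<=` [set t | \sum_(i < m.+1) tnth t i = m.+1%:R].
  move=> t [/= t1 /andP[+ _]]; rewrite -[m.+2%:R]natr1 addrK => mt.
  apply/eqP; rewrite eq_le mt andbT -[X in _ <= X%:R]card_ord -sumr_const.
  by apply: ler_sum => i _; have /andP[] := t1 i.
apply: (subset_measure0 _ _ BH); last exact: lebesgue_hyperplane.
- apply: measurable_boxset; rewrite (_ : mkset _ = `[m.+2%:R - 1, m.+2%:R]%classic).
    exact: measurable_itv.
  by apply/seteqP; split => y; rewrite /= in_itv.
- exact: (measurable_tuple_sum_preimage _ (f := id) (P := [set m.+1%:R])).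
Qed.

Lemma bin_div_fact (R : realType) n i : (i <= n)%N ->
  'C(n, i)%:R / n`!%:R = (i`!%:R * (n - i)`!%:R)^-1 :> R.
Proof.
move=> le_in; have f0 j : j`!%:R != 0 :> R by rewrite pnatr_eq0 -lt0n fact_gt0.
apply: (mulIf (f0 n)); rewrite divfK// -(bin_fact le_in) !natrM.
by rewrite mulrCA mulVf ?mulr1// mulf_neq0.
Qed.

Theorem theorem4p8 (R : realType) (d : nat) (k : R)
    (hd : (1 <= d)%N) (hk1 : 1 <= k) (hkd : k <= d%:R) :
  boundary_volume (polar (rho d k)) =
  (2 ^+ d * d%:R *
   (\sum_(0 <= i < Num.truncn k)
       (-1) ^+ i * (k - 1 - i%:R) ^+ (d - 1) / ((i`!)%:R * ((d - i - 1)`!)%:R)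
    + Num.sqrt d%:R *
      \sum_(0 <= i < (Num.truncn k).+1)
       (-1) ^+ i * (k - i%:R) ^+ (d - 1) / ((i`!)%:R * ((d - i)`!)%:R)))%:E.
Proof.
case: d hd hkd => // m _ hkd.
have k0 : 0 <= k by apply: le_trans hk1.
have truncm : (Num.truncn k <= m.+1)%N.
  by rewrite leqNgt truncn_gt_nat -ltNge (le_lt_trans hkd)// ltr_nat.
set V1 := \sum_(0 <= i < Num.truncn k) _.
set V2 := \sum_(0 <= i < (Num.truncn k).+1) _.
have V1E : iter m bdiff (tpow m) (k - 1) = V1.
  rewrite (@bdiff_tpow_trunc R m m (Num.truncn k))//; last first.
    by move=> i; rewrite truncn_gt_nat lerBrDr natr1.
  apply: eq_big_nat => i /andP[_ ik].
  have im : (i <= m)%N by rewrite -ltnS (leq_trans ik).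
  rewrite subnAC subn1 /= -(bin_div_fact R im).
  by rewrite !mulrA; congr (_ / _); rewrite mulrAC.
(* The binomials have upper index [m.+1] while the powers carry the factorial of [m]. The remaining
   [m.+1] is the [d] in front of the second sum; for the first sum it comes from counting facets. *)
have V2E : iter m.+1 bdiff (tpow m) k = m.+1%:R * V2.
  rewrite (@bdiff_tpow_trunc R m.+1 m (Num.truncn k).+1)//; last first.
    by move=> i; rewrite ltnS truncn_ge_nat.
  rewrite mulr_sumr; apply: eq_big_nat => i /andP[_ ik].
  have im : (i <= m.+1)%N by rewrite -ltnS (leq_trans ik)// ltnS.
  rewrite subn1 /= -(bin_div_fact R im) factS natrM invfM.
  have m0 : m.+1%:R != 0 :> R by rewrite pnatr_eq0.
  rewrite -!mulrA [RHS]mulrCA; congr (_ * _).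
  by rewrite [RHS]mulrCA [X in _ = _ * X]mulrCA mulVKf// mulrCA.
rewrite /boundary_volume (facets_polar_rho hk1 hkd) esum_image; last first.
  apply: polyhedron_face_inj => *; first exact: rho_normal_center.
  exact: rho_normal_center_lt.
rewrite esum_finType; last by move=> *; exact: flat_volume_ge0.
rewrite big_sumType/=.
rewrite (eq_bigr (fun=> (2 ^+ m * V1)%:E)); last first.
  by move=> [i b] Dj; rewrite (facet_inl_volume hk1 hkd Dj) V1E.
rewrite [X in (_ + X)%E](eq_bigr
  (fun=> (Num.sqrt m.+1%:R * (m.+1%:R * V2))%:E)); last first.
  by move=> e De; rewrite (facet_inr_volume hk1 hkd De) V2E.
rewrite !sumEFin -EFinD; congr EFin.
(* There are [2 * d] coordinate facets, or none when [k = 1 < d]; in that case [V1] reduces to a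
   multiple of [0 ^+ m] with [m] positive. *)
have -> : \sum_(ib : 'I_m.+1 * bool | rho_facet k (inl ib)) 2 ^+ m * V1 =
    2 ^+ m.+1 * m.+1%:R * V1.
  rewrite /rho_facet/=; have [_|] := boolP ((1 < k) || (m == 0)%N).
    rewrite sumr_const card_prod card_ord card_bool -[LHS]mulr_natr natrM exprS.
    by ring.
  rewrite negb_or -leNgt => /andP[k1 m0]; rewrite big_pred0_eq.
  have {k1} k1 : k = 1 by apply/eqP; rewrite eq_le k1.
  rewrite -V1E k1 subrr (@bdiff_tpow_trunc R m m 1)//.
    by rewrite big_nat1 subr0 expr0n (negbTE m0) mul0r !mulr0.
  by move=> [|i]; rewrite ?lexx// lern0.
(* There are [2 ^+ d] sign facets, or none when [k = d]; in that case the slab volume, and with it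
   [V2], is zero. *)
have -> : \sum_(e : {ffun 'I_m.+1 -> bool} | rho_facet k (inr e))
    Num.sqrt m.+1%:R * (m.+1%:R * V2) =
    2 ^+ m.+1 * (Num.sqrt m.+1%:R * (m.+1%:R * V2)).
  rewrite /rho_facet/=; have [_|] := boolP (k < m.+1%:R).
    rewrite sumr_const card_ffun card_ord card_bool.
    by rewrite -[LHS]mulr_natl natrX.
  rewrite -leNgt => km; rewrite big_pred0_eq -V2E.
  have -> : k = m.+1%:R by apply/eqP; rewrite eq_le hkd.
  by rewrite bdiff_tpow_slab_max !mulr0.
by ring.
Qed.
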